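(* Let $\lambda,\mu$ be partitions with at most $n$ parts and let $r,s\in\mathbb Z_{>0}^n$ be such that $r_i\le r_{i+1}$ and $s_i\le s_{i+1}$ for each $1\le i\le n-1$ with $\mu_i<\lambda_{i+1}$. Then \[ g^{\mathrm{row}(r,s)}_{\lambda/\mu}(x;\alpha,\beta)=\det\Big(h_{\lambda_i-\mu_j-i+j}\big[X_{[r_j,s_i]}-A_{\lambda_i-1}+A_{\mu_j}+B_{i-1}-B_{j-1}\big]\Big)_{i,j=1}^n, \] \[ g^{\mathrm{col}(r,s)}_{\lambda'/\mu'}(x;\alpha,\beta)=\det\Big(e_{\lambda_i-\mu_j-i+j}\big[X_{[r_j,s_i]}-A_{i-1}+A_{j-1}+B_{\lambda_i-1}-B_{\mu_j}\big]\Big)_{i,j=1}^n. \]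
   Context: Indeterminates $x=(x_1,x_2,\dots)$, $\alpha=(\alpha_i)$, $\beta=(\beta_i)$; $A_m=\alpha_1+\dots+\alpha_m$, $B_m=\beta_1+\dots+\beta_m$ ($=0$ for $m\le0$); $X_{[r,s]}=x_r+\dots+x_s$ ($=0$ if $r>s$). For a formal $\mathbb Z$-linear combination $Z=\sum_vc_vv$ of finitely many indeterminates, $h_m[Z]$ and $e_m[Z]$ are the coefficients of $t^m$ in $\prod_v(1-vt)^{-c_v}$ and $\prod_v(1+vt)^{c_v}$ (both $0$ for $m<0$). Partitions are padded with zeros. The skew shape $\lambda/\mu$ consists of cells $(i,j)$ with $\mu_i<j\le\lambda_i$ (empty-row conventions: if $\mu\not\subseteq\lambda$ there are no fillings, so the polynomials below are $0$); $\lambda'/\mu'$ consists of cells $(i,j)$ with $\mu_j<i\le\lambda_j$. A reverse plane partition of a skew shape is a filling $T$ of its cells with positive integers weakly increasing along rows and columns. A marked reverse plane partition is such a $T$ in which each entry $T(i,j)$ such that $(i,j+1)$ is a cell and $T(i,j)=T(i,j+1)$ may be marked. Its weight is $\mathrm{wt}(T)=\prod_{(i,j)}w(i,j)$, with $w(i,j)=-\alpha_j$ if $T(i,j)$ is marked; $w(i,j)=\beta_{i-1}$ if $T(i,j)$ is unmarked, $(i-1,j)$ is a cell and $T(i,j)=T(i-1,j)$ as integers; $w(i,j)=x_{T(i,j)}$ otherwise. $g^{\mathrm{row}(r,s)}_{\lambda/\mu}(x;\alpha,\beta)$ is the sum of $\mathrm{wt}(T)$ over marked reverse plane partitions of shape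 $\lambda/\mu$ with $r_i\le T(i,j)\le s_i$ for all cells; $g^{\mathrm{col}(r,s)}_{\lambda'/\mu'}(x;\alpha,\beta)$ is the sum of $\mathrm{wt}(T)$ over marked reverse plane partitions of shape $\lambda'/\mu'$ with $r_j\le T(i,j)\le s_j$ for all cells. *)

(* Defs.v *)
From HB Require Import structures.
From mathcomp Require Import all_boot all_order all_algebra finmap.
From mathcomp.multinomials Require Import monalg.

Set Implicit Arguments.
Unset Strict Implicit.
Unset Printing Implicit Defensive.

Import GRing.Theory.
Local Open Scope fset_scope.
Local Open Scope ring_scope.

(** * Indeterminates *)

(* Indices start at 1; [x_ 0], [alpha_ 0] and [beta_ 0] exist but never occur
   in the weights or in the plethystic arguments below. *)
Inductive indet := x_ of nat | alpha_ of nat | beta_ of nat.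

Definition indet_code (v : indet) : nat + (nat + nat) :=
  match v with
  | x_ i => inl i | alpha_ i => inr (inl i) | beta_ i => inr (inr i)
  end.
Definition indet_decode (c : nat + (nat + nat)) : indet :=
  match c with
  | inl i => x_ i | inr (inl i) => alpha_ i | inr (inr i) => beta_ i
  end.
Lemma indet_codeK : cancel indet_code indet_decode. Proof. by case. Qed.
HB.instance Definition _ := Countable.copy indet (can_type indet_codeK).

(* The polynomial ring Z[x, alpha, beta]. *)
Notation zpoly := {malg int[{cmonom indet}]}.

Definition ivar (v : indet) : zpoly := << ucm v >>.

(* Formal Z-linear combinations of finitely many indeterminates. They must not
   be confused with linear polynomials: h_m[Z] and e_m[Z] depend on the
   coefficients of Z as formal multiplicities. *)
Notation zcomb := {malg int[indet]}.

(* Index ranges are nat-valued. Since A_m = B_m = 0 for m <= 0, it is harmless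
   that A_(k-1) is written [A_ k.-1], also for k = 0. *)
Definition X_ (r s : nat) : zcomb := \sum_(r <= k < s.+1) << x_ k >>.
Definition A_ (m : nat) : zcomb := \sum_(1 <= k < m.+1) << alpha_ k >>.
Definition B_ (m : nat) : zcomb := \sum_(1 <= k < m.+1) << beta_ k >>.

(** * Formal power series in t, as coefficient sequences *)

Section Series.
Variable R : comNzRingType.

Definition fps := nat -> R.
Definition fps_one : fps := fun m => (m == 0%N)%:R.
Definition fps_mul (f g : fps) : fps :=
  fun m => \sum_(i < m.+1) f i * g (m - i)%N.
Definition fps_exp (f : fps) (n : nat) : fps := iter n (fps_mul f) fps_one.

Definition fps_lin (w : R) : fps :=
  fun m => match m with 0 => 1 | 1 => w | _ => 0 end.
Definition fps_geom (w : R) : fps := fun m => (- w) ^+ m.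

Lemma fps_lin_geom (w : R) : fps_mul (fps_lin w) (fps_geom w) =1 fps_one.
Proof.
move=> [|m]; rewrite /fps_mul /fps_one.
  by rewrite big_ord1 /= mul1r.
rewrite !big_ord_recl /= big1 => [|i _]; last by rewrite mul0r.
rewrite /fps_geom /bump /= subn0 subn1 /= addr0 mul1r exprS mulNr.
by rewrite addrC subrr.
Qed.

(* (1 + w t)^c for c in Z; the negative powers are those of [fps_geom w],
   which is the inverse of 1 + w t by [fps_lin_geom]. *)
Definition fps_binom (w : R) (c : int) : fps :=
  match c with
  | Posz n => fps_exp (fps_lin w) n
  | Negz n => fps_exp (fps_geom w) n.+1
  end.

Definition fps_coef (f : fps) (m : int) : R :=
  if m is Posz k then f k else 0.

(* [ev] gives the values in R of the indeterminates; see [ivar]. *)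
Variable ev : indet -> R.

Definition h_coef (m : int) (Z : zcomb) : R :=
  fps_coef
    (\big[fps_mul/fps_one]_(v <- msupp Z) fps_binom (- ev v) (- mcoeff v Z)) m.

Definition e_coef (m : int) (Z : zcomb) : R :=
  fps_coef
    (\big[fps_mul/fps_one]_(v <- msupp Z) fps_binom (ev v) (mcoeff v Z)) m.

End Series.

(** * Partitions and skew shapes *)

Definition is_part (la : seq nat) : bool := sorted geq la && (0%N \notin la).

(* The i-th term of a sequence, counted from 1, padded with zeros. *)
Definition at1 (u : seq nat) (i : nat) : nat :=
  if i is k.+1 then nth 0%N u k else 0%N.

Definition subpart (mu la : seq nat) : bool :=
  all (fun i => at1 mu i <= at1 la i)%N (iota 1 (size mu)).

Definition skew (la mu : seq nat) : {fset nat * nat} :=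
  [fset c in [seq (i, j) | i <- iota 1 (size la),
                           j <- index_iota (at1 mu i).+1 (at1 la i).+1]].

(* For partitions this is the shape la'/mu'. *)
Definition skew_conj (la mu : seq nat) : {fset nat * nat} :=
  [fset (c.2, c.1) | c in skew la mu].

Lemma in_skew (la mu : seq nat) (i j : nat) :
  ((i, j) \in skew la mu) = (at1 mu i < j <= at1 la i)%N.
Proof.
rewrite inE; apply/allpairsPdep/idP => [[i' [j' [_ + [-> ->]]]]|ij].
  by rewrite mem_index_iota ltnS.
exists i, j; split=> //; last by rewrite mem_index_iota ltnS.
rewrite mem_iota; case: i ij => [|i] /= /andP[lt_j le_j].
  by move: (leq_trans lt_j le_j).
rewrite add1n ltnS ltnNge; apply/negP => le_i.
by rewrite nth_default // in le_j; move: (leq_trans lt_j le_j).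
Qed.

Lemma in_skew_conj (la mu : seq nat) (i j : nat) :
  ((i, j) \in skew_conj la mu) = (at1 mu j < i <= at1 la j)%N.
Proof.
rewrite -in_skew; apply/imfsetP/idP => [[[a b] /= ab [-> ->]] //|ji].
by exists (j, i).
Qed.

(** * Marked reverse plane partitions *)

Section MRPP.
Variables (R : comNzRingType) (ev : indet -> R).
Variable (D : {fset nat * nat}).

Definition is_rpp (M : nat) (T : {ffun D -> 'I_M.+1}) : bool :=
  [forall c : D, (0 < T c)%N] &&
  [forall c : D, forall d : D,
     ((val c).1 == (val d).1) && ((val c).2 <= (val d).2)%N
     || ((val c).2 == (val d).2) && ((val c).1 <= (val d).1)%N
     ==> (T c <= T d)%N].

(* [S] is the set of marked cells. *)
Definition is_marking (M : nat) (T : {ffun D -> 'I_M.+1}) (S : {set D}) : bool :=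
  [forall c in S, exists d : D,
     (val d == ((val c).1, (val c).2.+1)) && (T d == T c)].

Definition cell_wt (M : nat) (T : {ffun D -> 'I_M.+1}) (S : {set D}) (c : D) : R :=
  if c \in S then - ev (alpha_ (val c).2)
  else if [exists d : D, (((val d).1.+1, (val d).2) == val c) && (T d == T c)]
  then ev (beta_ (val c).1.-1)
  else ev (x_ (T c)).

(* Sum of the weights of the marked reverse plane partitions of shape D with
   lo c <= T c <= hi c for all cells c. Bounding the entries by the maximum
   of hi makes the fillings a finite type without excluding any of them. *)
Definition mrpp_sum (lo hi : nat * nat -> nat) : R :=
  \sum_(T : {ffun D -> 'I_(\max_(c : D) hi (val c)).+1}
          | is_rpp T && [forall c : D, (lo (val c) <= T c <= hi (val c))%N])
    \sum_(S : {set D} | is_marking T S)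
      \prod_(c : D) cell_wt T S c.

End MRPP.

Definition g_row (R : comNzRingType) (ev : indet -> R)
    (la mu r s : seq nat) : R :=
  if subpart mu la then
    mrpp_sum ev (skew la mu) (fun c => at1 r c.1) (fun c => at1 s c.1)
  else 0.

Definition g_col (R : comNzRingType) (ev : indet -> R)
    (la mu r s : seq nat) : R :=
  if subpart mu la then
    mrpp_sum ev (skew_conj la mu) (fun c => at1 r c.2) (fun c => at1 s c.2)
  else 0.

(** * Entries of the determinants; i and j are counted from 1 *)

Definition h_entry (R : comNzRingType) (ev : indet -> R)
    (la mu r s : seq nat) (i j : nat) : R :=
  h_coef ev ((at1 la i)%:Z - (at1 mu j)%:Z - i%:Z + j%:Z)
    (X_ (at1 r j) (at1 s i) - A_ (at1 la i).-1 + A_ (at1 mu j)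
     + B_ i.-1 - B_ j.-1).

Definition e_entry (R : comNzRingType) (ev : indet -> R)
    (la mu r s : seq nat) (i j : nat) : R :=
  e_coef ev ((at1 la i)%:Z - (at1 mu j)%:Z - i%:Z + j%:Z)
    (X_ (at1 r j) (at1 s i) - A_ i.-1 + A_ j.-1
     + B_ (at1 la i).-1 - B_ (at1 mu j)).

(* Main.v *)
Require Import Defs.
From HB Require Import structures.
From Stdlib Require Import FunctionalExtensionality.
From mathcomp Require Import all_boot all_order all_algebra perm finmap.
From mathcomp.multinomials Require Import monalg.
From mathcomp Require Import zify ring.

(** Both identities follow from one recursion. Take a skew shape nu / mu whose
    row i has entries at most t i, let S be the largest bound of a nonempty row,
    c the topmost row attaining it, and p = nu c. Either T(c,p) < S, and t c may
    be lowered to S - 1; or T(c,p) = S, and then all cells below (c,p) in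
    column p also contain S, so the column segment can be removed and contributes
    a product of explicit weights. In the determinant, h_m[Z + v] = h_m[Z] + v
    h_(m-1)[Z + v] splits row c into the two corresponding rows, and rewrites each
    lower row of the segment as a combination of the reduced row and the
    reduced row above it; the coefficients of the reduced rows are the weights.
    These identities can fail in entries that link two disconnected parts of
    the shape, but such entries do not influence the determinant. The column
    version is the same recursion on the shape rotated by 180 degrees, with the
    entries complemented and e_m in place of h_m. *)

Set Implicit Arguments.
Unset Strict Implicit.
Unset Printing Implicit Defensive.

Import GRing.Theory.
Local Open Scope ring_scope.

(** * Determinants with zero blocks *)

Lemma inj_card_le (n : nat) (s : 'S_n) (P Q : {set 'I_n}) :
  (forall a, a \in P -> s a \in Q) -> (#|P| <= #|Q|)%N.
Proof.
move=> PQ; rewrite -(card_imset _ (@perm_inj _ s)); apply: subset_leq_card.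
by apply/subsetP => _ /imsetP[a aP ->]; apply: PQ.
Qed.

(** Pigeonhole: otherwise [s] would map [i] together with all indices above [k] into the indices
    above [k]. *)
Lemma perm_cut (n : nat) (s : 'S_n) (i : 'I_n) (k : nat) :
  (i <= k < s i)%N -> exists2 a : 'I_n, (k < a)%N & (s a <= k)%N.
Proof.
move=> /andP[ik ki].
have [/existsP[a /andP[]]|] := boolP [exists a : 'I_n, (k < a) && (s a <= k)]%N.
  by exists a.
rewrite negb_exists => /forallP no.
have := @inj_card_le _ s (i |: [set a : 'I_n | (k < a)%N]) [set a : 'I_n | (k < a)%N].
have iP : i \notin [set a : 'I_n | (k < a)%N] by rewrite inE -leqNgt.
rewrite cardsU1 iP add1n ltnn => le; suff: false by []; apply: le => a.
rewrite !inE => /orP[/eqP-> //|ka]; rewrite ltnNge.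
by have := no a; rewrite ka.
Qed.

Section Det.
Variables (R : comNzRingType) (n : nat).

(* A permutation using an entry (i, j) with i <= k < j also uses an entry (a, b)
   with b <= k < a. *)
Lemma det_cut (A B : 'M[R]_n) :
  (forall i j : 'I_n, A i j = B i j \/
     exists k, (i <= k < j)%N /\
       forall a b : 'I_n, (k < a)%N -> (b <= k)%N -> A a b = 0 /\ B a b = 0) ->
  \det A = \det B.
Proof.
move=> AB; apply: eq_bigr => s _; congr (_ * _).
have [/forallP eqAB|] := boolP [forall i, A i (s i) == B i (s i)].
  by apply: eq_bigr => i _; apply/eqP.
rewrite negb_forall => /existsP[i /eqP neq].
have [//|[k [ik cut]]] := AB i (s i).
have [a ka sak] := perm_cut ik; have [A0 B0] := cut _ _ ka sak.
by rewrite (bigD1 a) //= A0 mul0r (bigD1 a) //= B0 mul0r.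
Qed.

(** The Frobenius-Koenig criterion: a permutation avoiding the block would inject [P] into the
    complement of [Q], which is too small. *)
Lemma det_zero_block (A : 'M[R]_n) (P Q : {set 'I_n}) :
  (n < #|P| + #|Q|)%N ->
  (forall a b, a \in P -> b \in Q -> A a b = 0) -> \det A = 0.
Proof.
move=> cardPQ A0; apply: big1 => s _.
have [/existsP[a /andP[aP saQ]]|] := boolP [exists a, (a \in P) && (s a \in Q)].
  by rewrite (bigD1 a) //= A0 // mul0r mulr0.
rewrite negb_exists => /forallP no.
have: (#|P| <= #|~: Q|)%N.
  apply: (@inj_card_le _ s) => a aP; rewrite inE.
  by have := no a; rewrite aP.
by rewrite [#|~: Q|]cardsCs setCK card_ord; have := max_card Q; rewrite card_ord; lia.
Qed.

Lemma card_ord_ge (k : 'I_n) : #|[set a : 'I_n | (k <= a)%N]| = (n - k)%N.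
Proof.
rewrite -sum1dep_card -(big_mkord (fun i => (k <= i)%N) (fun=> 1%N)) sum1_count.
have -> : index_iota 0 n = iota 0 k ++ iota k (n - k).
  by rewrite /index_iota -iotaD subn0 subnKC // ltnW.
rewrite count_cat; have /eqP-> : count (fun i => (k <= i)%N) (iota 0 k) == 0%N.
  by rewrite -leqn0 leqNgt -has_count; apply/hasPn => i; rewrite mem_iota; lia.
rewrite add0n -[RHS](size_iota k); apply/eqP; rewrite -all_count.
by apply/allP => i; rewrite mem_iota => /andP[].
Qed.

Lemma card_ord_le (k : 'I_n) : #|[set a : 'I_n | (a <= k)%N]| = k.+1.
Proof.
rewrite -(card_imset _ (@rev_ord_inj n)).
have -> : [set rev_ord a | a in [set a : 'I_n | (a <= k)%N]] =
          [set a : 'I_n | (rev_ord k <= a)%N].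
  apply/setP => a; rewrite -[a in LHS]rev_ordK (mem_imset _ _ (@rev_ord_inj n)).
  by rewrite !inE /=; have := ltn_ord a; have := ltn_ord k; lia.
by rewrite card_ord_ge /=; have := ltn_ord k; lia.
Qed.

(** The block has [k.+1] rows and [n - k] columns, one more in total than [n]. *)
Lemma det_zero_corner_ur (A : 'M[R]_n) (k : 'I_n) :
  (forall a b : 'I_n, (a <= k <= b)%N -> A a b = 0) -> \det A = 0.
Proof.
move=> A0; apply: (@det_zero_block _ [set a : 'I_n | (a <= k)%N]
                                     [set a : 'I_n | (k <= a)%N]).
  by rewrite card_ord_ge card_ord_le; have := ltn_ord k; lia.
by move=> a b; rewrite !inE => ak kb; rewrite A0 // ak.
Qed.

Lemma det_zero_corner_ll (A : 'M[R]_n) (k : 'I_n) :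
  (forall a b : 'I_n, (b <= k <= a)%N -> A a b = 0) -> \det A = 0.
Proof.
by move=> A0; rewrite -det_tr; apply: (@det_zero_corner_ur _ k) => a b; rewrite mxE; apply: A0.
Qed.

(** The reversal acts on rows and on columns, so its sign enters squared. The column formula needs
    this because rotating the shape exchanges the roles of the two indices. *)
Lemma det_rev_tr (F : 'I_n -> 'I_n -> R) :
  \det (\matrix_(i, j) F (rev_ord j) (rev_ord i)) = \det (\matrix_(i, j) F i j).
Proof.
pose s := perm (@rev_ord_inj n).
have -> : \matrix_(i, j) F (rev_ord j) (rev_ord i) =
    (row_perm s (col_perm s (\matrix_(i, j) F i j)))^T.
  by apply/matrixP => i j; rewrite !mxE !permE.
rewrite det_tr row_permE col_permE !det_mulmx !det_perm odd_permV.
by rewrite mulrC -mulrA -expr2 sqrr_sign mulr1.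
Qed.
End Det.

(** * The recursion *)

Section Peeling.
Variables (R : comNzRingType) (n : nat) (la mu r s : nat -> nat).
Variables (D Y : finType) (pos : D -> nat * nat) (vl : Y -> nat).
Variable wt : nat -> nat -> nat -> bool -> bool -> R.
Variables EV EW : nat -> nat -> nat -> nat -> R.

(* Rows are numbered from 0 and columns from 1. [EV i p t] is the row of the
   determinant for a row i of length p with entries at most t; [EW i p t] is the
   one to use when the entry t has been removed from the cell (i, p + 1). The
   booleans in [wt i j v up right] tell whether the cells above and to the right
   of (i, j) exist and have the same entry v. *)
Notation row c := (pos c).1.
Notation col c := (pos c).2.
Local Open Scope nat_scope.

Hypothesis pos_inj : injective pos.
Hypothesis pos_in : forall c, row c < n /\ mu (row c) < col c <= la (row c).
Hypothesis pos_surj : forall i j, i < n -> mu i < j <= la i -> exists c, pos c = (i, j).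
Hypothesis vl_inj : injective vl.
Hypothesis vl_surj :
  forall i v, i < n -> mu i < la i -> r i <= v <= s i -> exists y, vl y = v.
Hypothesis mu_anti : forall i j, i <= j -> j < n -> mu j <= mu i.
Hypothesis la_anti : forall i j, i <= j -> j < n -> la j <= la i.
Hypothesis mu_le_la : forall i, i < n -> mu i <= la i.
Hypothesis flag :
  forall i, i.+1 < n -> mu i < la i.+1 -> r i <= r i.+1 /\ s i <= s i.+1.
Hypothesis r_gt0 : forall i, i < n -> 0 < r i.

(** In the top cell of the segment the entry either drops below [S] or is removed, hence the two
    terms of [EV_last] and [EW_last]. In a lower cell the first term is the reduced row above, which
    a row operation eliminates. *)
Hypothesis EV_last : forall i p S j, i < n -> j < n -> mu j < la j ->
  r j <= S <= s i -> mu i < p <= la i ->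
  (EV i p S j = EV i p S.-1 j + wt i p S false false * EW i p.-1 S j)%R.
Hypothesis EW_last : forall i p S j, i < n -> j < n -> mu j < la j ->
  r j <= S <= s i -> mu i < p < la i ->
  (EW i p S j = EV i p S.-1 j + wt i p S false true * EW i p.-1 S j)%R.
Hypothesis EV_below : forall i p S j, i.+1 < n -> j < n -> mu j < la j ->
  r j <= S <= s i.+1 -> mu i < p <= la i.+1 ->
  (EV i.+1 p S j = EW i p.-1 S j + wt i.+1 p S true false * EW i.+1 p.-1 S j)%R.
Hypothesis EW_below : forall i p S j, i.+1 < n -> j < n -> mu j < la j ->
  r j <= S <= s i.+1 -> mu i < p < la i.+1 ->
  (EW i.+1 p S j = EW i p.-1 S j + wt i.+1 p S true true * EW i.+1 p.-1 S j)%R.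
Hypothesis EV_one : forall i t, i < n -> EV i (mu i) t i = 1%R.
Hypothesis EW_one : forall i t, i < n -> EW i (mu i) t i = 1%R.
Hypothesis EV_zero : forall i p t j, i < n -> j < n -> p <= la i ->
  p + j < mu j + i -> EV i p t j = 0%R.
Hypothesis EW_zero : forall i p t j, i < n -> j < n -> p <= la i ->
  p + j < mu j + i -> EW i p t j = 0%R.
Hypothesis EV_empty : forall i p t j, i <= j -> j < n -> mu j < p <= la i ->
  t < r j -> EV i p t j = 0%R.

(** * Fillings and states of the recursion *)

Definition le_cell (c d : D) : bool :=
  (row c == row d) && (col c <= col d) || (col c == col d) && (row c <= row d).

Definition rpp (T : {ffun D -> Y}) : bool :=
  [forall c, forall d, le_cell c d ==> (vl (T c) <= vl (T d))].

Definition flagged (T : {ffun D -> Y}) : bool :=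
  [forall c, r (row c) <= vl (T c) <= s (row c)].

Definition eq_up (T : {ffun D -> Y}) (c : D) : bool :=
  [exists d, [&& (row d).+1 == row c, col d == col c & T d == T c]].

Definition eq_right (T : {ffun D -> Y}) (c : D) : bool :=
  [exists d, [&& row d == row c, col d == (col c).+1 & T d == T c]].

Definition weight (T : {ffun D -> Y}) (c : D) : R :=
  wt (row c) (col c) (vl (T c)) (eq_up T c) (eq_right T c).

(* A state of the recursion: the entries outside the shape nu / mu are those
   of f, and the entries of row i of nu / mu are at most t i. *)
Definition completion (nu t : nat -> nat) (f T : {ffun D -> Y}) : bool :=
  [&& rpp T, flagged T &
      [forall c, if col c <= nu (row c) then vl (T c) <= t (row c) else T c == f c]].

Definition state_sum (nu t : nat -> nat) (f : {ffun D -> Y}) : R :=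
  (\sum_(T | completion nu t f T) \prod_(c | (col c <= nu (row c))%N) weight T c)%R.

(** Decides between [EW] and [EV]: if the first removed cell of row [i] holds [t i], then an entry
    [t i] in the last remaining cell has an equal right neighbour. *)
Definition touches (nu t : nat -> nat) (f : {ffun D -> Y}) (i : nat) : bool :=
  [exists c, [&& row c == i, col c == (nu i).+1 & vl (f c) == t i]].

Definition entry (nu t : nat -> nat) (f : {ffun D -> Y}) (i j : nat) : R :=
  if touches nu t f i then EW i (nu i) (t i) j else EV i (nu i) (t i) j.

Definition mxn (F : nat -> nat -> R) : 'M[R]_n := (\matrix_(i < n, j < n) F i j)%R.

(** By [valid_top], every removed entry is at least every current bound of a nonempty row. So
    monotonicity across the boundary of [nu] is automatic, and a row whose bound has just been
    lowered touches nothing. *)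
Record valid (nu t : nat -> nat) (f : {ffun D -> Y}) : Prop := Valid {
  valid_anti : forall i j, i <= j -> j < n -> nu j <= nu i;
  valid_mu : forall i, i < n -> mu i <= nu i;
  valid_la : forall i, i < n -> nu i <= la i;
  valid_flag : forall i, i.+1 < n -> mu i < nu i.+1 -> t i <= t i.+1;
  valid_bound : forall i, i < n -> mu i < nu i -> r i <= t i <= s i;
  valid_rpp : forall c d, nu (row c) < col c -> nu (row d) < col d ->
    le_cell c d -> vl (f c) <= vl (f d);
  valid_flagged : forall c, nu (row c) < col c -> r (row c) <= vl (f c) <= s (row c);
  valid_top : forall i c, i < n -> mu i < nu i -> nu (row c) < col c ->
    t i <= vl (f c) }.

Lemma rppP T c d : rpp T -> le_cell c d -> vl (T c) <= vl (T d).
Proof. by move=> /forallP/(_ c)/forallP/(_ d)/implyP. Qed.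

Lemma chain_le (nu t : nat -> nat) (a b : nat) :
  (forall i, i.+1 < n -> mu i < nu i.+1 -> t i <= t i.+1) ->
  a <= b < n -> (forall k, a <= k < b -> mu k < nu k.+1) -> t a <= t b.
Proof.
move=> tP; elim: b => [|b IH] /andP[ab bn] conn; first by move: ab; rewrite leqn0 => /eqP->.
have [<- //|neq] := eqVneq a b.+1.
have {}ab : a <= b by lia.
apply: leq_trans (tP b bn (conn b _)); last by lia.
by apply: IH => [|k kb]; [lia|apply: conn; lia].
Qed.

(** If [nu k.+1 <= mu k], then [nu a <= mu b] whenever [b <= k < a], so the whole lower left block
    at [k] lies in the zero region and [det_cut] applies. *)
Lemma det_cut_shape (nu : nat -> nat) (F G : nat -> nat -> R) :
  (forall i j, i <= j -> j < n -> nu j <= nu i) ->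
  (forall i j, i < n -> j < n ->
     F i j = G i j \/ exists2 k, i <= k < j & nu k.+1 <= mu k) ->
  (forall i j, i < n -> j < n -> nu i + j < mu j + i -> F i j = 0%R /\ G i j = 0%R) ->
  (\det (mxn F) = \det (mxn G))%R.
Proof.
move=> nuA FG F0; apply: det_cut => i j; rewrite !mxE.
have [->|[k ik cut]] := FG i j (ltn_ord i) (ltn_ord j); [by left|right].
exists k; split=> // a b ka bk; rewrite !mxE; apply: F0 => //.
have h1 := nuA k.+1 a ka (ltn_ord a).
have kn : k < n by apply: leq_trans (ltn_ord a); apply: ltnW.
by have h2 := mu_anti bk kn; lia.
Qed.

Lemma entry_zero (nu t : nat -> nat) f i j : i < n -> j < n -> nu i <= la i ->
  nu i + j < mu j + i -> entry nu t f i j = 0%R.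
Proof. by move=> *; rewrite /entry; case: ifP => _; [apply: EW_zero|apply: EV_zero]. Qed.

Lemma state_sum_infeasible (nu t : nat -> nat) f i :
  i < n -> mu i < nu i <= la i -> t i < r i -> state_sum nu t f = 0%R.
Proof.
move=> ltin /andP[ne le_la] tr; apply: big1_seq => T.
have [|c cE] := @pos_surj i (nu i) ltin; first by rewrite ne.
case/andP=> /and3P[_ /forallP/(_ c) + /forallP/(_ c)].
by rewrite cE /= leqnn; lia.
Qed.

(** Rows up to [c] and columns from [c] on form a zero block, up to disconnected entries: along a
    connected stretch from [i] to [j] through [c] one has [t i <= t c < r c <= r j], so [EV_empty]
    applies. *)
Lemma det_infeasible (nu t : nat -> nat) f c :
  (forall i j, i <= j -> j < n -> nu j <= nu i) ->
  (forall i, i < n -> nu i <= la i) ->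
  (forall i, i.+1 < n -> mu i < nu i.+1 -> t i <= t i.+1) ->
  c < n -> mu c < nu c -> t c < r c ->
  (forall i, i <= c -> mu i < nu i -> ~~ touches nu t f i) ->
  (\det (mxn (entry nu t f)) = 0)%R.
Proof.
move=> nuA nula tP cn ne tr notW.
pose G i j := if i <= c <= j then 0%R else entry nu t f i j.
rewrite (@det_cut_shape nu _ G) //.
- apply: (@det_zero_corner_ur _ _ _ (Ordinal cn)) => a b /= acb.
  by rewrite mxE /G acb.
- move=> i j ltin ltjn; rewrite /G; case: ifP => [/andP[ic cj]|]; last by left.
  have [/hasP[k] | /hasPn conn] := boolP (has (fun k => nu k.+1 <= mu k) (iota i (j - i))).
    by rewrite mem_iota => ik cut; right; exists k => //; lia.
  left; have {}conn k : i <= k < j -> mu k < nu k.+1.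
    by move=> ik; rewrite ltnNge; apply: conn; rewrite mem_iota; lia.
  have nei : mu i < nu i.
    have [->//|neq] := eqVneq i c; have ic1 : i.+1 < n by lia.
    by have := conn i; have := nuA i i.+1 (leqnSn i) ic1; lia.
  rewrite /entry (negPf (notW i ic nei)); apply: EV_empty => //; first by lia.
    have := mu_anti cj ltjn; have := nuA _ _ ic cn; have := nula _ ltin; lia.
  have h1 : t i <= t c by apply: chain_le tP _ _ => [|k ik]; [lia|apply: conn; lia].
  have h2 : r c <= r j.
    apply: (@chain_le la) => [k kn mk||k ck]; [by have [] := flag kn mk|lia|].
    apply: leq_trans (conn k _) (nula _ _); lia.
  lia.
- move=> i j ltin ltjn lt; rewrite /G.
  by rewrite entry_zero //; [case: ifP|apply: nula].
Qed.

(** * One step of the recursion *)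

Section Step.
Variables (nu t : nat -> nat) (f : {ffun D -> Y}) (c : nat) (y : Y) (e : D).
Hypothesis ok : valid nu t f.
Hypothesis c_n : c < n.
Hypothesis c_ne : mu c < nu c.
Hypothesis t_max : forall i, i < n -> mu i < nu i -> t i <= t c.
Hypothesis c_min : forall i, i < c -> mu i < nu i -> t i < t c.
Hypothesis yE : vl y = t c.
Hypothesis eE : pos e = (c, nu c).

Let S := t c.
Let p := nu c.
(** The rows that end in column [p], from [c] downwards; they are consecutive because [nu]
    decreases. *)
Let run i := (c <= i) && (nu i == p).
Let runc d := run (row d) && (col d == p).

(* State A is reached when T(c, p) < S, state B when T(c, p) = S. *)
Let tA (i : nat) := if i == c then S.-1 else t i.
Let nuB i := if run i then p.-1 else nu i.
Let fB : {ffun D -> Y} := [ffun d => if runc d then y else f d].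

(** The weight of the removed cell of row [i]: only the top cell of the segment has no equal entry
    above it. *)
Let w i : R := wt i p S (c < i) (touches nu t f i).

Let p_gt0 : 0 < p. Proof. by rewrite /p; lia. Qed.

Let run_c : run c. Proof. by rewrite /run leqnn eqxx. Qed.

Let run_mu i : i < n -> run i -> mu i < p.
Proof. by move=> ltin /andP[ci _]; have := mu_anti ci ltin; rewrite /p; lia. Qed.

(** Consecutive rows of the run share column [p], so their bounds increase weakly from [t c], which
    is already maximal. *)
Let run_t i : i < n -> run i -> t i = S.
Proof.
move=> ltin ri; have /andP[ci /eqP nui] := ri.
apply/eqP; rewrite eqn_leq t_max //=; last by rewrite nui run_mu.
apply: (chain_le (valid_flag ok)) => [|k ck]; first by rewrite ci.
have h1 : mu k <= mu c by apply: mu_anti; lia.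
have h2 : nu i <= nu k.+1 by apply: (valid_anti ok) => //; lia.
by move: nui; rewrite /p; lia.
Qed.

Let nuB_le i : nuB i <= nu i.
Proof. by rewrite /nuB; case: ifP => // /andP[_ /eqP->]; apply: leq_pred. Qed.

Let in_nuB d : (col d <= nuB (row d)) = (col d <= nu (row d)) && ~~ runc d.
Proof.
rewrite /nuB /runc; case: ifP => /= [/andP[_ /eqP->]|_]; last by rewrite andbT.
by have := p_gt0; lia.
Qed.

Let touchesB i : i < n -> touches nuB t fB i = run i || touches nu t f i.
Proof.
move=> ltin; rewrite /touches /nuB; case: ifP => ri /=.
  have [|d dE] := @pos_surj i p ltin.
    by rewrite run_mu //=; have /andP[_ /eqP <-] := ri; apply: (valid_la ok).
  apply/existsP; exists d; rewrite ffunE /runc dE /= eqxx ri eqxx prednK // eqxx /=.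
  by rewrite yE (run_t ltin ri).
apply: eq_existsb => d; rewrite ffunE /runc.
by have [->|//] := eqVneq (row d) i; rewrite ri.
Qed.

Let S_gt0 : 0 < S.
Proof. by have := r_gt0 c_n; have := valid_bound ok c_n c_ne; rewrite /S; lia. Qed.

Let p_la : p <= la c. Proof. exact: (valid_la ok c_n). Qed.

(** The matrix [entry] with the rows of the run expanded by the recursions. *)
Let F i j : R :=
  if run i then
    ((if i == c then EV c p S.-1 j else EW i.-1 p.-1 S j) + w i * EW i p.-1 S j)%R
  else entry nu t f i j.

(** Nonemptiness of row [j] provides [r j <= t j <= S], which the recursions require. *)
Let entry_run i j : i < n -> j < n -> mu j < nu j -> entry nu t f i j = F i j.
Proof.
move=> ltin ltjn nej; rewrite /F; case: ifP => // ri.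
have /andP[ci /eqP nui] := ri.
have mui := run_mu ltin ri; have ti := run_t ltin ri.
have boundi : mu i < nu i by rewrite nui.
have := valid_bound ok ltin boundi; have := valid_bound ok ltjn nej.
have := t_max ltjn nej; have := valid_la ok ltjn; have := valid_la ok ltin.
rewrite -/S ti nui => lai laj tj rtj rti; rewrite /entry ti nui /w.
have touch_la : touches nu t f i -> p < la i.
  case/existsP => d /and3P[/eqP di /eqP dp _].
  by have [_] := pos_in d; rewrite di dp nui => /andP[].
case: (eqVneq i c) => [ic|neq].
  rewrite ic ltnn -ic; case: ifP => Wi.
    by apply: EW_last => //; [lia|lia|rewrite mui touch_la].
  by apply: EV_last => //; lia.
have ci' : c < i by rewrite ltn_neqAle eq_sym neq.
case: i ltin ri ci nui mui ti boundi lai rti touch_la neq ci' => // i.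
move=> ltin ri ci nui mui ti boundi lai rti touch_la neq ci'; rewrite ci' /=.
have muip : mu i < p by have := @mu_anti c i; rewrite /p; lia.
case: ifP => Wi; first by apply: EW_below => //; [lia|lia|rewrite muip touch_la].
by apply: EV_below => //; lia.
Qed.

Let F_zero i j : i < n -> j < n -> nu i + j < mu j + i -> F i j = 0%R.
Proof.
move=> ltin ltjn lt; rewrite /F; have lai := valid_la ok ltin.
case: ifP => [ri|_]; last by apply: entry_zero.
have /andP[ci /eqP nui] := ri; rewrite nui in lt lai.
rewrite [EW i _ _ _]EW_zero //; [|by lia|by lia].
rewrite mulr0 addr0; case: eqP => [ic|neq].
  by apply: EV_zero => //; lia.
apply: EW_zero => //; [by lia| |by have := p_gt0; lia].
by have := @la_anti i.-1 i; lia.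
Qed.

(** Removed entries are at least [S], hence exceed [S.-1]: row [c] is untouched after its bound is
    lowered. *)
Let entryA i j : entry nu tA f i j = if i == c then EV c p S.-1 j else entry nu t f i j.
Proof.
rewrite /entry /touches /tA; case: eqP => // ->; case: ifP => // /existsP[d].
case/and3P=> /eqP dc /eqP dp /eqP dS.
have out : nu (row d) < col d by rewrite dc dp.
by have := valid_top ok c_n c_ne out; rewrite dS -/S; have := S_gt0; lia.
Qed.

(** After the removal each row of the run ends next to an entry [S], which is its bound. *)
Let entryB i j : i < n ->
  entry nuB t fB i j = if run i then EW i p.-1 S j else entry nu t f i j.
Proof.
move=> ltin; rewrite /entry touchesB // /nuB.
by case: (boolP (run i)) => //= ri; rewrite (run_t ltin ri).
Qed.

Lemma step_det :
  (\det (mxn (entry nu t f)) =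
   \det (mxn (entry nu tA f)) +
   (\prod_(i < n | run i) w i) * \det (mxn (entry nuB t fB)))%R.
Proof.
(* An empty row [j] disconnects the shape just above it, at [k = j.-1]. *)
have cut i j : i < n -> j < n -> ~~ (mu j < nu j) -> i < j ->
    exists2 k, i <= k < j & nu k.+1 <= mu k.
  move=> ltin ltjn nej ij; exists j.-1; first by lia.
  by have := @mu_anti j.-1 j; rewrite prednK; lia.
have FE i j : i < n -> j < n -> entry nu t f i j = F i j \/
    exists2 k, i <= k < j & nu k.+1 <= mu k.
  move=> ltin ltjn; have [nej|nej] := boolP (mu j < nu j).
    by left; apply: entry_run.
  have [ij|ji] := ltnP i j; first by right; apply: cut.
  (* For an empty row [j <= i] with [i] in the run, the entry is strictly below the diagonal and
     both sides vanish. *)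
  left; rewrite /F; case: ifP => // ri.
  have [mui nui] : mu i < p /\ nu i = p by split; [apply: run_mu|case/andP: ri => _ /eqP].
  have h1 := valid_anti ok ji ltin.
  have ij : j < i by rewrite ltn_neqAle ji andbT; apply: contraNneq nej => ->; lia.
  have lt : nu i + j < mu j + i by lia.
  have := F_zero ltin ltjn lt; rewrite /F ri => ->.
  by apply: entry_zero => //; apply: valid_la ok _ ltin.
rewrite (@det_cut_shape nu _ F (valid_anti ok)) //; last first.
  by move=> i j ltin ltjn lt; rewrite entry_zero ?F_zero //; apply: valid_la ok _ ltin.
pose FA (i j : nat) := if i == c then EV c p S.-1 j else F i j.
pose FB (i j : nat) := if i == c then (w c * EW c p.-1 S j)%R else F i j.
(* Row [c] of [F] is a sum of two rows, and the determinant is linear in that row. *)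
have -> : (\det (mxn F) = \det (mxn FA) + \det (mxn FB))%R.
  rewrite -[X in (X + _)%R]mul1r -[X in (_ + X)%R]mul1r.
  apply: (@determinant_multilinear _ _ _ _ _ (Ordinal c_n)).
  - by apply/rowP => j; rewrite !mxE /FA /FB /F eqxx run_c !mul1r.
  - apply/matrixP => i j; rewrite !mxE /FA; case: eqP => //=; rewrite /bump; lia.
  - apply/matrixP => i j; rewrite !mxE /FB; case: eqP => //=; rewrite /bump; lia.
congr (_ + _)%R.
  apply: (@det_cut_shape nu _ _ (valid_anti ok)) => i j ltin ltjn.
    rewrite entryA /FA; case: eqP => _; first by left.
    by have [->|] := FE i j ltin ltjn; [left|right].
  move=> lt; rewrite entryA /FA; case: eqP => [ic|_]; last first.
    by rewrite F_zero // entry_zero //; apply: valid_la ok _ ltin.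
  by rewrite EV_zero // -?ic //; rewrite /p -ic.
(* The lower rows are bidiagonal combinations of the reduced rows. *)
pose L := (\matrix_(i < n, k < n) if run i then
   if k == i then w i else ((c < i) && (k.+1 == i))%N%:R else (k == i)%:R)%R : 'M[R]_n.
have -> : mxn FB = L *m mxn (entry nuB t fB).
  apply/matrixP => i j; rewrite !mxE /FB.
  have entB (k : 'I_n) := @entryB k j (ltn_ord k).
  have [ri|nri] := boolP (run i); last first.
    rewrite (bigD1 i) //= big1 => [|k ki]; rewrite !mxE (negPf nri).
      by rewrite eqxx mul1r addr0 /F (negPf nri) entB (negPf nri); case: eqP nri => // ->; rewrite run_c.
    by rewrite (negPf ki) mul0r.
  rewrite (bigD1 i) //= !mxE ri eqxx entB ri.
  have [ic|neq] := eqVneq (i : nat) c.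
    rewrite big1 ?addr0 ?ic // => k ki; rewrite !mxE ri (negPf ki) ic ltnn.
    by rewrite mul0r.
  have /andP[ci /eqP nui] := ri.
  have i1n : i.-1 < n by apply: leq_ltn_trans (leq_pred _) (ltn_ord i).
  have ci' : c < i by rewrite ltn_neqAle eq_sym neq.
  rewrite (bigD1 (Ordinal i1n)) /=; last by rewrite -(inj_eq val_inj) /=; lia.
  rewrite big1 ?addr0 => [|k /andP[ki ki1]]; last first.
    rewrite !mxE ri (negPf ki) ci' /=.
    case: eqP => [kE|]; last by rewrite mul0r.
    by move: ki1; rewrite -(inj_eq val_inj) /= -kE eqxx.
  rewrite !mxE ri -(inj_eq val_inj) /= ci' prednK ?eqxx /=; last by lia.
  have -> : (i.-1 == i) = false by lia.
  rewrite (@entryB i.-1 j i1n) /F ri (negPf neq) mul1r addrC.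
  suff -> : run i.-1 by [].
  rewrite /run eqn_leq; have -> : c <= i.-1 by lia.
  have := @valid_anti _ _ _ ok i.-1 i (leq_pred _) (ltn_ord i).
  have := @valid_anti _ _ _ ok c i.-1; rewrite nui -/p; lia.
rewrite det_mulmx; congr (_ * _)%R.
(* [L] is lower triangular, with diagonal [w i] on the run and 1 elsewhere. *)
rewrite det_trig; last first.
  apply/is_trig_mxP => i k ik; rewrite mxE.
  have -> : (k == i) = false by rewrite -(inj_eq val_inj) /=; lia.
  by case: ifP => // _; rewrite (_ : (k.+1 == i :> nat) = false) ?andbF //; lia.
rewrite [RHS]big_mkcond /=; apply: eq_bigr => i _; rewrite mxE eqxx.
by case: ifP.
Qed.

(** Row [c] increases weakly, so bounding its last entry by [S.-1] bounds all of it. *)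
Let completionA T :
  completion nu t f T && (vl (T e) < S) = completion nu tA f T.
Proof.
apply/andP/and3P => [[/and3P[mono fl /forallP comp] ltS]|[mono fl /forallP comp]].
  split=> //; apply/forallP => d; have := comp d; case: ifP => // din le.
  rewrite /tA; case: eqP => // dc.
  have: le_cell d e by rewrite /le_cell eE /= -dc din eqxx.
  by move=> /(rppP mono); lia.
have tA_le i : tA i <= t i by rewrite /tA; case: eqP => // ->; apply: leq_pred.
split; last by have := comp e; rewrite eE /= leqnn /tA eqxx; have := S_gt0; lia.
apply/and3P; split=> //; apply/forallP => d; have := comp d.
by case: ifP => // _ le; apply: leq_trans le _.
Qed.

(** From [e] down the run, the entries in column [p] are at least [S] by monotonicity and at most
    [S] by the bounds. *)
Let completionB T :
  completion nu t f T && ~~ (vl (T e) < S) = completion nuB t fB T.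
Proof.
rewrite -leqNgt; apply/andP/and3P.
  case=> /and3P[mono fl /forallP comp] leS; split=> //; apply/forallP => d.
  have := comp d; rewrite in_nuB ffunE.
  have [rd|nrd] := boolP (runc d); last by rewrite andbT.
  have [dn _] := pos_in d; have /andP[rd1 /eqP cd] := rd.
  have /andP[cd1 /eqP nud] := rd1; rewrite andbF nud cd leqnn (run_t dn rd1) => le.
  have: le_cell e d by rewrite /le_cell eE /= cd1 -/p cd eqxx orbT.
  move=> /(rppP mono) le2; rewrite -(inj_eq vl_inj) yE -/S; lia.
case=> mono fl /forallP comp; split; last first.
  have re : runc e by rewrite /runc eE run_c /= /p eqxx.
  by have := comp e; rewrite in_nuB ffunE re andbF => /eqP->; rewrite yE.
apply/and3P; split=> //; apply/forallP => d; have := comp d.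
rewrite in_nuB ffunE; have [rd|nrd] := boolP (runc d); last by rewrite andbT.
have [dn _] := pos_in d; have /andP[rd1 /eqP cd] := rd.
have /andP[cd1 /eqP nud] := rd1; rewrite andbF nud cd leqnn (run_t dn rd1).
by move=> /eqP->; rewrite yE.
Qed.

Let weight_run T d : completion nuB t fB T -> runc d -> weight T d = w (row d).
Proof.
case/and3P=> mono fl /forallP comp rd.
have Ty a : runc a -> T a = y.
  by move=> ra; have := comp a; rewrite in_nuB ffunE ra andbF => /eqP.
have /andP[rd1 /eqP cd] := rd; have /andP[cd1 /eqP nud] := rd1.
have [dn _] := pos_in d.
rewrite /weight /w (Ty d rd) yE cd -/S; congr wt.
- apply/existsP/idP => [[a /and3P[/eqP ra /eqP ca /eqP Ta]]|ltcd].
    (* A cell above [(c, p)] still belongs to [nu], so its entry is less than [S] because [c] is the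
       topmost row attaining the maximum. *)
    rewrite ltn_neqAle cd1 andbT; apply/negP => /eqP rc.
    have [an /andP[mua _]] := pos_in a.
    have ac : row a < c by lia.
    have nua := @valid_anti _ _ _ ok (row a) c (ltnW ac) c_n.
    have nra : runc a = false by rewrite /runc /run [c <= _]leqNgt ac.
    have nea : mu (row a) < nu (row a) by rewrite -/p in nua; lia.
    have := comp a; rewrite in_nuB nra andbT ca cd {1}/p nua Ta (Ty d rd) yE.
    by have := c_min ac nea; lia.
  have r1n : (row d).-1 < n by lia.
  have nu1 : nu (row d).-1 = p.
    apply/eqP; rewrite eqn_leq; apply/andP; split.
      by rewrite /p; apply: (valid_anti ok) => //; lia.
    by rewrite -nud; apply: (valid_anti ok) => //; lia.
  have run1 : run (row d).-1 by rewrite /run nu1 eqxx andbT; lia.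
  have [|a aE] := @pos_surj (row d).-1 p r1n.
    by rewrite run_mu //= -nu1; apply: valid_la ok _ r1n.
  have ra : runc a by rewrite /runc aE /= run1 eqxx.
  exists a; rewrite (Ty a ra) (Ty d rd) aE /= cd !eqxx prednK ?eqxx //; lia.
(* The right neighbour lies outside [nu], where [T] agrees with [f]. *)
- apply: eq_existsb => a; rewrite cd nud.
  have [ra|//] := eqVneq (row a) (row d); have [ca|//] /= := eqVneq (col a) p.+1.
  have nra : runc a = false by rewrite /runc ca; apply/negP => /andP[_ /eqP]; lia.
  have := comp a; rewrite in_nuB ffunE nra andbT ra nud ca ltnn => /eqP->.
  by rewrite -(inj_eq vl_inj) (Ty d rd) yE (run_t dn rd1).
Qed.

Let prod_run : (\prod_(d | runc d) w (row d) = \prod_(i < n | run i) w i)%R.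
Proof.
rewrite (partition_big (fun d => Ordinal (proj1 (pos_in d))) (fun i : 'I_n => run i)) /=.
  apply: eq_bigr => i ri.
  have [|d dE] := @pos_surj i p (ltn_ord i).
    by rewrite run_mu //=; have /andP[_ /eqP <-] := ri; apply: (valid_la ok).
  rewrite (@big_pred1 _ _ _ _ d) ?dE // => a.
  rewrite /= -[a == d](inj_eq pos_inj) dE -val_eqE /= /runc.
  case: (pos a) => x z /=; rewrite xpair_eqE andbC.
  by case: eqP => //= ->; rewrite ri.
by move=> d /andP[].
Qed.

Lemma step_sum :
  (state_sum nu t f = state_sum nu tA f +
   (\prod_(i < n | run i) w i) * state_sum nuB t fB)%R.
Proof.
rewrite /state_sum (bigID (fun T : {ffun D -> Y} => vl (T e) < S)) /=.
congr (_ + _)%R; first by apply: eq_bigl => T; apply: completionA.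
rewrite big_distrr /=; apply: eq_big => [T|T]; rewrite completionB // => comp.
rewrite (bigID runc) /= -prod_run; congr (_ * _)%R; last first.
  by apply: eq_bigl => d; rewrite in_nuB.
apply: eq_big => [d|d /andP[_ rd]]; last exact: weight_run.
by rewrite /runc /run; case: eqP => [->|]; rewrite ?andbF //; case: eqP => [->|]; rewrite ?andbF // leqnn.
Qed.

(** If the flag condition links rows [c.-1] and [c], then [t c.-1 < t c] by the choice of [c], so
    lowering [t c] by one preserves it. *)
Lemma step_validA : r c <= S.-1 -> valid nu tA f.
Proof.
move=> rS; split; [exact: valid_anti ok|exact: valid_mu ok|exact: valid_la ok|..].
- move=> i ltin ne; have le_t := valid_flag ok ltin ne; rewrite /tA.
  case: (eqVneq i.+1 c) => [ic|_]; last by case: eqP => [ic|_ //]; rewrite /S -ic; lia.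
  have -> : (i == c) = false by lia.
  suff: t i < t c by rewrite /S; lia.
  by apply: c_min; [lia|have := valid_anti ok (leqnSn i) ltin; lia].
- move=> i ltin ne; have := valid_bound ok ltin ne; rewrite /tA.
  by case: eqP => [->|//]; rewrite /S in rS *; lia.
- exact: valid_rpp ok.
- exact: valid_flagged ok.
- move=> i d ltin ne out; apply: leq_trans (valid_top ok ltin ne out).
  by rewrite /tA; case: eqP => [->|//]; rewrite /S; lia.
Qed.

Lemma step_validB : valid nuB t fB.
Proof.
have out d : nuB (row d) < col d -> runc d \/ nu (row d) < col d.
  by rewrite ltnNge in_nuB negb_and negbK -ltnNge => /orP[]; auto.
have topS d : nu (row d) < col d -> S <= vl (f d) by apply: valid_top.
split.
- move=> i j ij ltjn; have le_nu := valid_anti ok ij ltjn; rewrite /nuB.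
  case: ifP => rj; case: ifP => // ri.
    by have /andP[_ /eqP nuj] := rj; lia.
  have /andP[ci /eqP nui] := ri; move: rj; rewrite /run (leq_trans ci ij) /=.
  by rewrite nui in le_nu; lia.
- move=> i ltin; have := valid_mu ok ltin; rewrite /nuB; case: ifP => // ri _.
  by have := run_mu ltin ri; lia.
- by move=> i ltin; apply: leq_trans (nuB_le i) (valid_la ok ltin).
- by move=> i ltin ne; apply: (valid_flag ok ltin); apply: leq_trans ne (nuB_le _).
- by move=> i ltin ne; apply: (valid_bound ok ltin); apply: leq_trans ne (nuB_le _).
- move=> d a /out outd /out outa da; rewrite !ffunE.
  case: ifP => [rd|nrd]; first by case: ifP => // nra; rewrite yE topS //; case: outa; rewrite ?nra.
  case: outd; rewrite ?nrd // => outd.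
  case: ifP => [ra|nra]; last by case: outa; rewrite ?nra // => outa; apply: valid_rpp ok _ _ outd outa da.
  have /andP[/andP[ca /eqP nua] /eqP cola] := ra.
  case/orP: da => /andP[/eqP eq1 le1]; first by rewrite eq1 in outd; lia.
  have := valid_anti ok le1 (proj1 (pos_in a)); lia.
- move=> d /out outd; rewrite ffunE; case: ifP => [rd|nrd]; last first.
    by case: outd; rewrite ?nrd // => outd; apply: valid_flagged ok _ outd.
  have [dn _] := pos_in d; have /andP[rd1 _] := rd.
  rewrite yE -/S -(run_t dn rd1); apply: (valid_bound ok dn).
  by have /andP[_ /eqP->] := rd1; apply: run_mu.
- move=> i d ltin ne /out outd; have {}ne := leq_trans ne (nuB_le _).
  rewrite ffunE; case: ifP => [rd|nrd]; first by rewrite yE t_max.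
  by case: outd; rewrite ?nrd //; apply: valid_top.
Qed.
End Step.


(** * Induction along the recursion *)

Lemma state_sum_empty (nu t : nat -> nat) f :
  valid nu t f -> (forall i, i < n -> nu i = mu i) ->
  state_sum nu t f = \det (mxn (entry nu t f)).
Proof.
move=> ok nuE.
have out d : nu (row d) < col d by have [dn /andP[]] := pos_in d; rewrite nuE.
rewrite /state_sum (big_pred1 f) => [|T]; last first.
  apply/and3P/eqP => [[_ _ /forallP comp]|->].
    by apply/ffunP => d; have := comp d; rewrite leqNgt out => /eqP.
  split.
  - by apply/forallP => a; apply/forallP => d; apply/implyP; apply: (valid_rpp ok).
  - by apply/forallP => d; apply: (valid_flagged ok).
  - by apply/forallP => d; rewrite leqNgt out /= eqxx.
rewrite big_pred0 => [|d]; last by rewrite leqNgt out.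
(* For [nu = mu] the matrix is upper unitriangular. *)
rewrite -det_tr det_trig.
  rewrite big1 // => i _; rewrite !mxE /entry nuE //.
  by case: ifP => _; [apply: EW_one|apply: EV_one].
apply/is_trig_mxP => i j ij; rewrite !mxE entry_zero //.
  exact: (valid_la ok).
by rewrite nuE //; have := @mu_anti i j (ltnW ij) (ltn_ord j); lia.
Qed.

Lemma state_sum_det (nu t : nat -> nat) f :
  valid nu t f -> state_sum nu t f = \det (mxn (entry nu t f)).
Proof.
(* The measure is the sum of all row lengths and bounds: one branch lowers [t c], the other shortens
   row [c]. *)
move: {2}(\sum_(i < n) (nu i + t i)).+1 (ltnSn (\sum_(i < n) (nu i + t i))) => m.
elim: m nu t f => // m IH nu t f; rewrite ltnS => le_m ok.
have [/existsP[i0 ne0]|] := boolP [exists i : 'I_n, mu i < nu i]; last first.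
  rewrite negb_exists => /forallP empty; apply: state_sum_empty => // i ltin.
  have := empty (Ordinal ltin); have := valid_mu ok ltin; rewrite /=; lia.
have [im ne_im t_im] := @arg_maxnP _ i0 (fun i : 'I_n => mu i < nu i) (fun i => t i) ne0.
have t_im' i : i < n -> mu i < nu i -> t i <= t im.
  by move=> ltin ne; apply: (t_im (Ordinal ltin)).
have ex : exists i, [&& i < n, mu i < nu i & t i == t im].
  by exists im; rewrite ltn_ord ne_im eqxx.
case: (ex_minnP ex) => c /and3P[c_n c_ne /eqP tc] c_min'.
have t_max i : i < n -> mu i < nu i -> t i <= t c by rewrite tc; apply: t_im'.
have c_min i : i < c -> mu i < nu i -> t i < t c.
  move=> ic ne; rewrite ltn_neqAle t_max ?andbT //; last by apply: ltn_trans c_n.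
  apply/negP => /eqP tE; suff: c <= i by rewrite leqNgt ic.
  by apply: c_min'; rewrite ne tE tc eqxx (ltn_trans ic).
have cla := valid_la ok c_n; have bc := valid_bound ok c_n c_ne.
have [y yE] : exists y, vl y = t c by apply: (@vl_surj c) => //; lia.
have [e eE] : exists e, pos e = (c, nu c) by apply: pos_surj => //; rewrite c_ne.
have okB := step_validB ok c_n c_ne t_max yE.
rewrite (step_sum ok c_n c_ne t_max c_min yE eE) (step_det ok c_n c_ne t_max yE).
have tc0 : 0 < t c by have := r_gt0 c_n; lia.
rewrite [X in (_ + _ * X)%R](IH _ _ _ _ okB); last first.
  apply: leq_trans le_m; rewrite (bigD1 (Ordinal c_n)) //=.
  rewrite [X in _ <= X](bigD1 (Ordinal c_n)) //= leqnn eqxx -addSn leq_add //.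
    by rewrite -addSn leq_add2r prednK //; apply: leq_ltn_trans c_ne.
  apply: leq_sum => i _; rewrite leq_add2r; case: ifP => // /andP[_ /eqP ->]; exact: leq_pred.
congr (_ + _)%R.
(* If row [c] admits no value below [t c], the lowered state is not valid, but its sum and its
   determinant both vanish. *)
have [rS|Sr] := leqP (r c) (t c).-1.
  apply: IH; last first.
    by apply: (step_validA ok) yE _.
  apply: leq_trans le_m; rewrite (bigD1 (Ordinal c_n)) //=.
  rewrite [X in _ <= X](bigD1 (Ordinal c_n)) //= eqxx -addSn leq_add //.
    by rewrite -addnS leq_add2l prednK.
  by apply: leq_sum => i _; rewrite leq_add2l; case: eqP => // ->; apply: leq_pred.
rewrite (@state_sum_infeasible _ _ _ c) ?c_ne ?eqxx //.
rewrite (@det_infeasible _ _ _ c) ?eqxx //.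
- exact: (valid_anti ok).
- exact: (valid_la ok).
- move=> i ltin ne; have le_t := valid_flag ok ltin ne.
  case: (eqVneq i.+1 c) => [ic|_]; last by case: eqP => [ic|_ //]; rewrite -ic; lia.
  have -> : (i == c) = false by lia.
  suff: t i < t c by lia.
  by apply: c_min; [lia|have := valid_anti ok (leqnSn i) ltin; lia].
- move=> i ic nei; apply/existsP => -[d /and3P[/eqP di /eqP dc /eqP dt]].
  have out : nu (row d) < col d by rewrite dc di.
  have := valid_top ok c_n c_ne out; rewrite dt; case: eqP => [_|neq]; first lia.
  by have := c_min i; lia.
Qed.

Variable y0 : Y.

Theorem rpp_sum_det :
  (\sum_(T : {ffun D -> Y} | rpp T && flagged T) \prod_c weight T c =
   \det (mxn (fun i j => EV i (la i) (s i) j)))%R.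
Proof.
(* Any filling serves as initial [f], since no cell lies outside [la]. *)
pose f : {ffun D -> Y} := [ffun=> y0].
have in_la d : col d <= la (row d) by have [_ /andP[]] := pos_in d.
have -> : (\sum_(T : {ffun D -> Y} | rpp T && flagged T) \prod_c weight T c)%R =
    state_sum la s f.
  apply: eq_big => [T|T _]; last by apply: eq_bigl => d; rewrite in_la.
  rewrite /completion andbA; case: (boolP (rpp T && flagged T)) => //= /andP[_ /forallP fl].
  by apply/esym/forallP => d; rewrite in_la; have /andP[] := fl d.
have -> : mxn (fun i j => EV i (la i) (s i) j) = mxn (entry la s f).
  apply/matrixP => i j; rewrite !mxE /entry; case: ifP => // /existsP[d].
  case/and3P=> /eqP di /eqP dc _; have := in_la d; rewrite di dc; lia.
have sflag i : i.+1 < n -> mu i < la i.+1 -> s i <= s i.+1.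
  by move=> ltin ne; have [] := flag ltin ne.
(* A nonempty row with [s i < r i] makes both sides zero; otherwise the initial state is valid. *)
have [/existsP[i /andP[ne lt]]|] := boolP [exists i : 'I_n, (mu i < la i) && (s i < r i)].
  rewrite (@state_sum_infeasible _ _ _ i) ?ne ?leqnn ?(@det_infeasible _ _ _ i) //.
  move=> k ki _; apply/existsP => -[d /and3P[/eqP di /eqP dc _]].
  by have := in_la d; rewrite di dc; lia.
rewrite negb_exists => /forallP feas.
apply: state_sum_det; split=> //.
- move=> i ltin ne; have := feas (Ordinal ltin); rewrite /= ne /=; lia.
- by move=> a d; rewrite ltnNge in_la.
- by move=> d; rewrite ltnNge in_la.
- by move=> i d _ _; rewrite ltnNge in_la.
Qed.
End Peeling.

(** * Plethystic coefficients *)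

Section SeriesTheory.
Variable R : comNzRingType.
Implicit Types (f g h : fps R) (w : R).

(** The coefficient at [m] depends only on truncations, so commutativity and associativity are
    inherited from polynomials. *)
Lemma fps_mul_poly N f g m : (m < N)%N ->
  fps_mul f g m = ((\poly_(i < N) f i) * (\poly_(i < N) g i))`_m.
Proof.
move=> mN; rewrite coefM /fps_mul; apply: eq_bigr => i _.
by rewrite !coef_poly (leq_trans (ltn_ord i) mN) (leq_ltn_trans (leq_subr _ _) mN).
Qed.

Lemma fps_mulC : commutative (@fps_mul R).
Proof.
move=> f g; apply: functional_extensionality => m.
by rewrite !(fps_mul_poly _ _ (ltnSn m)) mulrC.
Qed.

Lemma fps_mulA : associative (@fps_mul R).
Proof.
move=> f g h; apply: functional_extensionality => m.
have coefP f1 f2 k : (k <= m)%N ->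
    (\poly_(i < m.+1) fps_mul f1 f2 i)`_k =
    ((\poly_(i < m.+1) f1 i) * (\poly_(i < m.+1) f2 i))`_k.
  by move=> km; rewrite coef_poly ltnS km (@fps_mul_poly m.+1).
rewrite !(fps_mul_poly _ _ (ltnSn m)).
transitivity (((\poly_(i < m.+1) f i) *
    ((\poly_(i < m.+1) g i) * (\poly_(i < m.+1) h i)))`_m).
  by rewrite coefM [RHS]coefM; apply: eq_bigr => i _; rewrite coefP // leq_subr.
rewrite mulrA coefM [RHS]coefM; apply: eq_bigr => i _.
by rewrite coefP // -ltnS.
Qed.

Lemma fps_mul1f : left_id (@fps_one R) (@fps_mul R).
Proof.
move=> f; apply: functional_extensionality => m.
rewrite /fps_mul big_ord_recl /fps_one mul1r subn0 big1 ?addr0 // => i _.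
by rewrite mul0r.
Qed.

HB.instance Definition _ := Monoid.isComLaw.Build (fps R) (@fps_one R) (@fps_mul R)
  fps_mulA fps_mulC fps_mul1f.

Lemma fps_binomS w c : fps_mul (fps_lin w) (fps_binom w c) = fps_binom w (c + 1).
Proof.
have linK f : fps_mul (fps_lin w) (fps_mul (fps_geom w) f) = f.
  rewrite fps_mulA -[RHS]fps_mul1f; congr fps_mul.
  by apply: functional_extensionality; apply: fps_lin_geom.
case: c => [k|[|k]]; first by rewrite -PoszD addn1.
  exact: linK.
by rewrite (_ : Negz k.+1 + 1 = Negz k); [apply: linK|lia].
Qed.

Lemma fps_coef_lin w f m :
  fps_coef (fps_mul (fps_lin w) f) m = fps_coef f m + w * fps_coef f (m - 1).
Proof.
case: m => [[|m]|m].
- by rewrite /= /fps_mul big_ord1 mul1r mulr0 addr0.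
- have -> : Posz m.+1 - 1 = Posz m by lia.
  rewrite /= /fps_mul !big_ord_recl big1 => [|i _]; last by rewrite mul0r.
  by rewrite /= mul1r addr0 subn0 subn1.
- have -> : Negz m - 1 = Negz m.+1 by lia.
  by rewrite /= mulr0 addr0.
Qed.

Lemma fps_binom_coef0 w c : fps_binom w c 0%N = 1.
Proof.
have exp0 f k : f 0%N = 1 -> fps_exp f k 0%N = 1.
  by move=> f0; elim: k => //= k IH; rewrite /fps_mul big_ord1 f0 IH mulr1.
by case: c => k; rewrite /= ?exp0 // /fps_mul big_ord1 exp0 // mulr1.
Qed.

Section Plethysm.
Variable ev : indet -> R.
Implicit Types (Z : zcomb) (v : indet) (m : int).

(** The two generating functions agree once the values and the multiplicities change sign; this
    transports every fact about [e_coef] to [h_coef]. *)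
Lemma h_coefE m Z : h_coef ev m Z = e_coef (fun v => - ev v) m (- Z).
Proof.
rewrite /h_coef /e_coef; congr (fps_coef _ m).
have -> : msupp (- Z) = msupp Z.
  by apply/fsetP => v; rewrite -!mcoeff_neq0 mcoeffN oppr_eq0.
by apply: eq_bigr => v _; rewrite mcoeffN.
Qed.

(** Adding [v] multiplies the generating function by [1 + v t]. *)
Lemma e_coefD m Z v :
  e_coef ev m (Z + << v >>) = e_coef ev m Z + ev v * e_coef ev (m - 1) Z.
Proof.
rewrite /e_coef -fps_coef_lin; congr (fps_coef _ m).
(* A common index set for both products, since [v] may enter or leave the support. *)
pose A := (v |` msupp Z)%fset.
have extend Z' : (msupp Z' `<=` A)%fset ->
    \big[@fps_mul R/@fps_one R]_(u <- msupp Z') fps_binom (ev u) (Z')@_u =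
    \big[@fps_mul R/@fps_one R]_(u <- A) fps_binom (ev u) (Z')@_u.
  move=> sub; apply: big_fset_incl => // u _ /mcoeff_outdom -> //.
rewrite !extend ?fsubsetUr //; last first.
  apply: fsubset_trans (msuppD_le _ _) _; rewrite fsetUC fsetSU //.
  by apply: fsubset_trans msuppU_le _.
have vA : v \in A by rewrite fset1U1.
rewrite !(big_fsetD1 v vA) /= fps_mulA fps_binomS.
congr fps_mul; first by rewrite mcoeffD mcoeffU eqxx.
rewrite ![\big[_/_]_(u <- _) _]big_seq; apply: eq_bigr => u.
by rewrite !inE => /andP[uv _]; rewrite mcoeffD mcoeffU eq_sym (negPf uv) addr0.
Qed.

Lemma e_coef_neg m Z : m < 0 -> e_coef ev m Z = 0.
Proof. by case: m. Qed.

Lemma e_coef0 Z : e_coef ev 0 Z = 1.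
Proof.
rewrite /e_coef /=; apply: (big_ind (fun f : fps R => f 0%N = 1)) => // [f g f0 g0|v _].
  by rewrite /fps_mul big_ord1 f0 g0 mulr1.
exact: fps_binom_coef0.
Qed.

(** The generating function is a product of [size l] linear factors. *)
Lemma e_coef_sum m (l : seq indet) :
  (size l)%:Z < m -> e_coef ev m (\sum_(v <- l) << v >>) = 0.
Proof.
elim: l m => [|v l IH] m lm.
  rewrite big_nil /e_coef; have -> : msupp (0 : zcomb) = fset0.
    by apply/fsetP => v; rewrite -mcoeff_neq0 mcoeff0 eqxx in_fset0.
  by rewrite big_nil; case: m lm => [[|m]|m].
by rewrite big_cons addrC e_coefD !IH ?mulr0 ?addr0 //; move: lm => /=; lia.
Qed.
End Plethysm.

Variable ev : indet -> R.
Implicit Types (Z : zcomb) (v : indet) (m : int).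

Lemma h_coefB m Z v :
  h_coef ev m (Z - << v >>) = h_coef ev m Z - ev v * h_coef ev (m - 1) Z.
Proof. by rewrite !h_coefE opprB addrC e_coefD mulNr. Qed.

Lemma h_coefD m Z v :
  h_coef ev m (Z + << v >>) = h_coef ev m Z + ev v * h_coef ev (m - 1) (Z + << v >>).
Proof. by rewrite -[in X in _ = X + _](addrK << v >> Z) h_coefB; ring. Qed.

Lemma h_coef_neg m Z : m < 0 -> h_coef ev m Z = 0.
Proof. by rewrite h_coefE; apply: e_coef_neg. Qed.

Lemma h_coef0 Z : h_coef ev 0 Z = 1.
Proof. by rewrite h_coefE e_coef0. Qed.

Lemma h_coef_sum m (l : seq indet) :
  (size l)%:Z < m -> h_coef ev m (- \sum_(v <- l) << v >>) = 0.
Proof. by rewrite h_coefE opprK; apply: e_coef_sum. Qed.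
End SeriesTheory.

(** * Splitting indeterminates off the plethystic arguments *)

Lemma X_recr (a b : nat) : (a <= b)%N -> (0 < b)%N -> X_ a b = X_ a b.-1 + << x_ b >>.
Proof. by case: b => // b ab _; rewrite /X_ big_nat_recr. Qed.

Lemma X_recl (a b : nat) : (a <= b)%N -> X_ a b = << x_ a >> + X_ a.+1 b.
Proof. by move=> ab; rewrite /X_ big_ltn. Qed.

Lemma X_empty (a b : nat) : (b < a)%N -> X_ a b = 0.
Proof. by move=> ba; rewrite /X_ big_geq. Qed.

Lemma A_rec (a : nat) : (0 < a)%N -> A_ a = A_ a.-1 + << alpha_ a >>.
Proof. by case: a => // a _; rewrite /A_ big_nat_recr. Qed.

Lemma B_rec (a : nat) : (0 < a)%N -> B_ a = B_ a.-1 + << beta_ a >>.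
Proof. by case: a => // a _; rewrite /B_ big_nat_recr. Qed.

(** Once the [x] part is empty, this counts the indeterminates left in an argument, so that
    [h_coef_sum] or [e_coef_sum] gives zero. *)
Lemma AB_diff (a b c d : nat) : (a <= b)%N -> (c <= d)%N ->
  exists2 l : seq indet, size l = (b - a + (d - c))%N &
    A_ b - A_ a + (B_ d - B_ c) = \sum_(v <- l) << v >>.
Proof.
move=> ab cd; exists (map alpha_ (index_iota a.+1 b.+1) ++ map beta_ (index_iota c.+1 d.+1)).
  by rewrite size_cat !size_map !size_iota; lia.
rewrite big_cat !big_map /A_ /B_ /=.
rewrite [\sum_(1 <= k < b.+1) _](@big_cat_nat _ _ _ a.+1) //=.
rewrite [\sum_(1 <= k < d.+1) _](@big_cat_nat _ _ _ c.+1) //=.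
by rewrite ![_ + _ - _]addrAC !subrr !add0r.
Qed.

(** * The row and column formulas *)

Lemma at1_anti (la : seq nat) (i j : nat) :
  is_part la -> (0 < i <= j)%N -> (at1 la j <= at1 la i)%N.
Proof.
case: i j => [|i] [|j] //= /andP[la_sorted _] ij.
have [lej|ltj] := leqP (size la) j; first by rewrite nth_default.
have := @sorted_leq_nth _ geq (fun _ _ _ h1 h2 => leq_trans h2 h1) leqnn 0%N la la_sorted.
by apply; rewrite ?inE //; apply: leq_ltn_trans ltj.
Qed.

Lemma at1_default (la : seq nat) (n i : nat) :
  (size la <= n)%N -> (n < i)%N -> at1 la i = 0%N.
Proof. by case: i => // i lan ni; rewrite /= nth_default //; lia. Qed.

Lemma subpartP (la mu : seq nat) :
  reflect (forall i, (at1 mu i <= at1 la i)%N) (subpart mu la).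
Proof.
apply: (iffP allP) => [sub i|sub i _]; last exact: sub.
have [ltmi|leim] := ltnP (size mu) i; first by rewrite (at1_default (leqnn _) ltmi).
by case: i leim => // i leim; apply: sub; rewrite mem_iota; lia.
Qed.

(** * Summation over the markings of a fixed filling *)

Section Marking.
Variables (R : comNzRingType) (ev : indet -> R) (D : {fset nat * nat}).

Definition markable M (T : {ffun D -> 'I_M.+1}) (c : D) : bool :=
  [exists d : D, (val d == ((val c).1, (val c).2.+1)) && (T d == T c)].

Definition up_equal M (T : {ffun D -> 'I_M.+1}) (c : D) : bool :=
  [exists d : D, (((val d).1.+1, (val d).2) == val c) && (T d == T c)].

(** Expanding the product over cells selects a set of marked cells; a set containing an unmarkable
    cell contributes a factor 0. *)
Lemma sum_markings M (T : {ffun D -> 'I_M.+1}) :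
  \sum_(S : {set D} | is_marking T S) \prod_(c : D) cell_wt ev T S c =
  \prod_(c : D) ((if up_equal T c then ev (beta_ (val c).1.-1) else ev (x_ (T c))) +
                 (if markable T c then - ev (alpha_ (val c).2) else 0)).
Proof.
rewrite [RHS](eq_bigr _ (fun c _ => addrC _ _)) bigA_distr big_mkcond /=.
apply: eq_bigr => S _; have [/forall_inP mark|] := boolP (is_marking T S).
  apply: eq_bigr => c _; rewrite /cell_wt; case: ifP => // cS.
  by rewrite /markable mark.
rewrite negb_forall => /existsP[c]; rewrite negb_imply => /andP[cS nmark].
by rewrite (bigD1 c) //= cS /markable (negPf nmark) mul0r.
Qed.
End Marking.

(** * The row formula as an instance of the recursion *)

Section Row.
Variables (R : comNzRingType) (ev : indet -> R) (n : nat) (la mu r s : seq nat).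
Hypotheses (la_part : is_part la) (la_size : (size la <= n)%N).
Hypotheses (mu_part : is_part mu) (sub : subpart mu la).
Hypothesis r_gt0 : forall i, (1 <= i <= n)%N -> (0 < at1 r i)%N.
Hypothesis flag : forall i, (1 <= i < n)%N -> (at1 mu i < at1 la i.+1)%N ->
  (at1 r i <= at1 r i.+1)%N /\ (at1 s i <= at1 s i.+1)%N.

Let Z (j t a b : nat) : zcomb :=
  X_ (at1 r j.+1) t - A_ a + A_ (at1 mu j.+1) + B_ b - B_ j.

Let ZX j t a b : (at1 r j.+1 <= t)%N -> (0 < t)%N ->
  Z j t a b = Z j t.-1 a b + << x_ t >>.
Proof. by move=> rt t0; rewrite /Z X_recr // (ACl (1*3*4*5*6*2)%AC). Qed.

Let ZA j t a b : (0 < a)%N -> Z j t a b = Z j t a.-1 b - << alpha_ a >>.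
Proof. by move=> a0; rewrite /Z (A_rec a0) opprD addrA (ACl (1*2*4*5*6*3)%AC). Qed.

Let ZB j t a b : Z j t a b.+1 = Z j t a b + << beta_ b.+1 >>.
Proof. by rewrite /Z (@B_rec b.+1) //= addrA (ACl (1*2*3*4*6*5)%AC). Qed.

Let idx (i p j : nat) : int := p%:Z - (at1 mu j.+1)%:Z - i.+1%:Z + j.+1%:Z.
Let EV i p t j := h_coef ev (idx i p j) (Z j t p.-1 i).
(** Replacing [A_ p.-1] by [A_ p] subtracts [alpha_ p] and so accounts for the mark that the last
    cell may carry when its right neighbour is equal. *)
Let EW i p t j := h_coef ev (idx i p j) (Z j t p i).
Let wt i j v (up right : bool) : R :=
  (if up then ev (beta_ i) else ev (x_ v)) + (if right then - ev (alpha_ j) else 0).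
Let pos (c : Defs.skew la mu) : nat * nat := ((val c).1.-1, (val c).2).

Let in_cell (c : Defs.skew la mu) :
  (0 < (val c).1 <= n)%N /\ (at1 mu (val c).1 < (val c).2 <= at1 la (val c).1)%N.
Proof.
case: c => [[i j] ij] /=; move: (ij); rewrite in_skew => mij; split=> //.
case: i {ij} mij => [|i] /= mij; first lia.
rewrite ltnNge; apply/negP => ni.
by have := @at1_default la n i.+1 la_size; rewrite /= ltnS => /(_ ni); lia.
Qed.

Let idx_pred i p j : (0 < p)%N -> idx i p.-1 j = idx i p j - 1.
Proof. by rewrite /idx; lia. Qed.

Let idx_up i p j : (0 < p)%N -> idx i.+1 p j = idx i p.-1 j.
Proof. by rewrite /idx; lia. Qed.

Lemma row_det : g_row ev la mu r s =
  \det (\matrix_(i < n, j < n) h_entry ev la mu r s i.+1 j.+1).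
Proof.
rewrite /g_row sub /mrpp_sum; set M := \max_(c : _) _.
have subP := subpartP _ _ sub.
have pos_in c : (pos c).1.+1 = (val c).1.
  by have [/andP[c0 _] _] := in_cell c; rewrite /= prednK.
have pos_inj : injective pos.
  move=> c d cd; apply: val_inj; have := pos_in c; have := pos_in d; rewrite cd => ->.
  by move: cd; rewrite /pos; case: (val c) (val d) => [? ?] [? ?] [_ ->] /= ->.
transitivity (\sum_(T : {ffun Defs.skew la mu -> 'I_M.+1} |
    rpp pos (@nat_of_ord M.+1) T &&
    flagged (fun i => at1 r i.+1) (fun i => at1 s i.+1) pos (@nat_of_ord M.+1) T)
    \prod_c weight pos (@nat_of_ord M.+1) wt T c); last first.
  transitivity (\det (mxn n (fun i j => EV i (at1 la i.+1) (at1 s i.+1) j))); last first.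
    by congr (\det _); apply/matrixP => i j; rewrite !mxE.
  apply: (@rpp_sum_det R n (fun i => at1 la i.+1) (fun i => at1 mu i.+1)
    (fun i => at1 r i.+1) (fun i => at1 s i.+1) _ _ pos (@nat_of_ord M.+1) wt EV EW) => //.
  - by move=> c; have [cn] := in_cell c; rewrite pos_in; split=> //; lia.
  - move=> i j ltin ij; have ijP : (i.+1, j) \in Defs.skew la mu by rewrite in_skew.
    by exists [` ijP]%fset.
  - exact: ord_inj.
  - move=> i v ltin ne /andP[_ vs].
    have ijP : (i.+1, at1 la i.+1) \in Defs.skew la mu by rewrite in_skew ne leqnn.
    have vM : (v < M.+1)%N.
      rewrite ltnS; apply: leq_trans vs _.
      exact: (@leq_bigmax _ (fun c : Defs.skew la mu => at1 s (val c).1) [` ijP]%fset).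
    by exists (Ordinal vM).
  - by move=> i j ij _; apply: at1_anti.
  - by move=> i j ij _; apply: at1_anti.
  - by move=> i ltin; apply: flag.
  - by move=> i ltin; apply: r_gt0.
  - move=> i p S j ltin ltjn ne /andP[rS _] /andP[mp _].
    have S0 : (0 < S)%N by apply: leq_trans rS; apply: r_gt0.
    by rewrite /EV /EW /wt (@ZX j S) // h_coefD -ZX // addr0 idx_pred //; lia.
  - move=> i p S j ltin ltjn ne /andP[rS _] /andP[mp _].
    have S0 : (0 < S)%N by apply: leq_trans rS; apply: r_gt0.
    rewrite /EV /EW /wt (@ZA j S p) ?h_coefB ?idx_pred; [|lia..].
    by rewrite {1}(@ZX j S) // h_coefD -ZX //; ring.
  (* The reduced row above has the same degree, and its argument lacks only [beta_ i.+1]. *)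
  - move=> i p S j ltin ltjn ne /andP[rS _] /andP[mp _].
    have p0 : (0 < p)%N by lia.
    by rewrite /EV /EW /wt ZB h_coefD -ZB -(@idx_up i p) // -(@idx_pred i.+1) // addr0.
  - move=> i p S j ltin ltjn ne /andP[rS _] /andP[mp _].
    have p0 : (0 < p)%N by lia.
    rewrite /EW /wt (@ZA j S p) // h_coefB (@idx_pred i.+1) // -(@idx_up i p) //.
    by rewrite {1}ZB h_coefD -ZB; ring.
  - by move=> i t ltin; rewrite /EV /idx subrr add0r addrC subrr h_coef0.
  - by move=> i t ltin; rewrite /EW /idx subrr add0r addrC subrr h_coef0.
  - by move=> i p t j _ _ _ lt; apply: h_coef_neg; rewrite /idx; lia.
  - by move=> i p t j _ _ _ lt; apply: h_coef_neg; rewrite /idx; lia.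
  (* With no [x] left, the argument is minus a sum of indeterminates whose number is one less than
     the degree. *)
  - move=> i p t j ij ltjn /andP[mp pl] tr; rewrite /EV /Z X_empty // add0r.
    have [l sz lE] := @AB_diff (at1 mu j.+1) p.-1 i j ltac:(lia) ij.
    have -> : - A_ p.-1 + A_ (at1 mu j.+1) + B_ i - B_ j = - \sum_(v <- l) << v >>.
      by rewrite -lE !opprD !opprK !addrA (ACl (1*2*4*3)%AC).
    by apply: h_coef_sum; rewrite sz /idx; lia.
  - exact: ord0.
have le_cellE c d : le_cell pos c d =
    ((val c).1 == (val d).1) && ((val c).2 <= (val d).2)%N
    || ((val c).2 == (val d).2) && ((val c).1 <= (val d).1)%N.
  by rewrite -!pos_in eqSS ltnS.
apply: eq_big => [T|T _].
  apply/andP/andP => -[].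
    case/andP=> _ /forallP mono bnd; split.
      apply/forallP => c; apply/forallP => d; have /forallP/(_ d) := mono c.
      by rewrite le_cellE.
    by apply/forallP => c; have /forallP/(_ c) := bnd; rewrite pos_in.
  move=> mono /forallP bnd.
  have bnd' c : (at1 r (val c).1 <= T c <= at1 s (val c).1)%N.
    by have := bnd c; rewrite pos_in.
  split; last by apply/forallP.
  apply/andP; split; apply/forallP => c.
    have [c1 _] := in_cell c; have /andP[rT _] := bnd' c.
    by apply: leq_trans rT; apply: r_gt0.
  apply/forallP => d; apply/implyP => cd; apply: (rppP mono).
  by rewrite le_cellE.
rewrite sum_markings; apply: eq_bigr => c _; rewrite /weight /wt.
have -> : eq_up pos T c = up_equal T c.
  apply: eq_existsb => d; rewrite andbA; congr (_ && _).
  by rewrite -eqSS !pos_in /=; case: (val c) => ? ?; rewrite xpair_eqE.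
have -> : eq_right pos T c = markable T c.
  apply: eq_existsb => d; rewrite andbA; congr (_ && _).
  by rewrite -eqSS !pos_in /=; case: (val d) => ? ?; rewrite xpair_eqE.
by [].
Qed.
End Row.

(** * The column formula by rotation and complementation *)

Section Col.
Variables (R : comNzRingType) (ev : indet -> R) (n : nat) (la mu r s : seq nat).
Hypotheses (la_part : is_part la) (la_size : (size la <= n)%N).
Hypotheses (mu_part : is_part mu) (sub : subpart mu la).
Hypothesis r_gt0 : forall i, (1 <= i <= n)%N -> (0 < at1 r i)%N.
Hypothesis flag : forall i, (1 <= i < n)%N -> (at1 mu i < at1 la i.+1)%N ->
  (at1 r i <= at1 r i.+1)%N /\ (at1 s i <= at1 s i.+1)%N.

Let N := at1 la 1.
Let M := \max_(c : skew_conj la mu) at1 s (val c).2.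
(** Larger than every bound and every entry, so that complementation is injective and the new lower
    bounds [K - s] are positive. *)
Let K := (\max_(i < n) (at1 r i.+1 + at1 s i.+1) + M).+1.

Let r_K i : (1 <= i <= n)%N -> (at1 r i <= K)%N.
Proof.
case: i => // i ltin; rewrite /K.
have := @leq_bigmax _ (fun i : 'I_n => (at1 r i.+1 + at1 s i.+1)%N) (Ordinal ltin).
by rewrite /=; lia.
Qed.

Let s_K i : (1 <= i <= n)%N -> (at1 s i < K)%N.
Proof.
case: i => // i ltin; rewrite /K.
have := @leq_bigmax _ (fun i : 'I_n => (at1 r i.+1 + at1 s i.+1)%N) (Ordinal ltin).
by rewrite /=; lia.
Qed.

Let la_N i : (1 <= i)%N -> (at1 la i <= N)%N.
Proof. by move=> i0; apply: at1_anti. Qed.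

(* Rotating by 180 degrees and replacing each entry v by K - v moves row i of the
   rotated shape to row n - i of la / mu, and a row of length p to one starting
   after column N - p. *)
Let Z (j u b q : nat) : zcomb :=
  X_ u (at1 s (n - j)) - A_ (n - j).-1 + A_ b + B_ (at1 la (n - j)).-1 - B_ q.

Let ZX j u b q : (u <= at1 s (n - j))%N -> Z j u b q = Z j u.+1 b q + << x_ u >>.
Proof. by move=> us; rewrite /Z X_recl // (ACl (2*3*4*5*6*1)%AC). Qed.

Let ZA j u b q : (0 < b)%N -> Z j u b q = Z j u b.-1 q + << alpha_ b >>.
Proof. by move=> b0; rewrite /Z (A_rec b0) addrA (ACl (1*2*3*5*6*4)%AC). Qed.

Let ZB j u b q : (0 < q)%N -> Z j u b q.-1 = Z j u b q + << beta_ q >>.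
Proof. by move=> q0; rewrite /Z (B_rec q0) opprD addrA addrNK. Qed.

Let idx (i p j : nat) : int :=
  (at1 la (n - j))%:Z - (N - p)%N%:Z - (n - j)%N%:Z + (n - i)%N%:Z.
Let EV i p t j := e_coef ev (idx i p j) (Z j (K - t) (n - i).-1 (N - p)).
(** For [K - t <= at1 s (n - j)] and [p < N], this trades [x_ (K - t)] for [beta_ (N - p)], the
    weight of the last cell when its right neighbour is equal. *)
Let EW i p t j := e_coef ev (idx i p j) (Z j (K - t).+1 (n - i).-1 (N - p).-1).
(** The rotation moves an equal entry above to the right, and an equal right neighbour, which
    permits a mark, to the cell above. *)
Let wt i j v (up right : bool) : R :=
  (if right then ev (beta_ (N - j)) else ev (x_ (K - v))) +
  (if up then - ev (alpha_ (n - i)) else 0).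

Let pos (c : skew_conj la mu) : nat * nat := (n - (val c).2, N.+1 - (val c).1)%N.
Let vl (y : 'I_M.+1) : nat := (K - y)%N.

Let in_cell (c : skew_conj la mu) :
  (0 < (val c).2 <= n)%N /\ (at1 mu (val c).2 < (val c).1 <= at1 la (val c).2)%N.
Proof.
case: c => [[i j] ij] /=; move: (ij); rewrite in_skew_conj => mij; split=> //.
case: j {ij} mij => [|j] /= mij; first lia.
rewrite ltnNge; apply/negP => nj.
by have := @at1_default la n j.+1 la_size; rewrite /= ltnS => /(_ nj); lia.
Qed.

Let idx_pred i p j : (0 < p <= N)%N -> idx i p.-1 j = idx i p j - 1.
Proof. by rewrite /idx; lia. Qed.

Let idx_up i p j : (0 < p <= N)%N -> (i.+1 < n)%N -> idx i.+1 p j = idx i p.-1 j.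
Proof. by rewrite /idx; lia. Qed.

(** The argument for row [i] has one [alpha] more than that for row [i.+1]; splitting it off yields
    the term that the mark weight [- alpha] compensates. *)
Let up_entry i p S j : (0 < p <= N)%N -> (i.+1 < n)%N ->
  EW i p.-1 S j = e_coef ev (idx i.+1 p j) (Z j (K - S).+1 (n - i.+1).-1 (N - p)) +
    ev (alpha_ (n - i.+1)) *
    e_coef ev (idx i.+1 p.-1 j) (Z j (K - S).+1 (n - i.+1).-1 (N - p)).
Proof.
move=> pN ltin; rewrite /EW -(@idx_up i p) // (@idx_pred i.+1) // -e_coefD -ZA; last by lia.
have -> : (N - p.-1).-1 = (N - p)%N by lia.
by have -> : (n - i).-1 = (n - i.+1)%N by lia.
Qed.

Let EWp i p S j : (0 < p <= N)%N ->
  EW i p.-1 S j = e_coef ev (idx i p.-1 j) (Z j (K - S).+1 (n - i).-1 (N - p)).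
Proof. by move=> pN; rewrite /EW; have -> : (N - p.-1).-1 = (N - p)%N by lia. Qed.

Lemma col_det : g_col ev la mu r s =
  \det (\matrix_(i < n, j < n) e_entry ev la mu r s i.+1 j.+1).
Proof.
rewrite /g_col sub /mrpp_sum -/M.
have subP := subpartP _ _ sub.
have pos1 c : (pos c).1 = (n - (val c).2)%N by [].
have pos2 c : (pos c).2 = (N.+1 - (val c).1)%N by [].
have pos_n c : (n - (pos c).1)%N = (val c).2.
  by have [/andP[_ c2] _] := in_cell c; rewrite pos1 subKn.
have cell_N (c : skew_conj la mu) : (0 < (val c).1 <= N)%N.
  by have [c2 c1] := in_cell c; have := @la_N (val c).2; lia.
have pos_N c : (N.+1 - (pos c).2)%N = (val c).1.
  by have := cell_N c; rewrite pos2; lia.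
have pos_N1 c : (N - (pos c).2)%N = (val c).1.-1.
  by have := cell_N c; rewrite pos2; lia.
have pos_inj : injective pos.
  move=> c d cd; apply: val_inj; have := pos_n c; have := pos_N c.
  by rewrite cd pos_n pos_N; case: (val c) (val d) => [? ?] [? ?] /= -> ->.
have vlK y : (K - vl y)%N = y by have := ltn_ord y; rewrite /vl /K; lia.
have vl_inj : injective vl by move=> y z yz; apply: ord_inj; rewrite -vlK yz vlK.
transitivity (\sum_(T : {ffun skew_conj la mu -> 'I_M.+1} |
    rpp pos vl T &&
    flagged (fun i => K - at1 s (n - i))%N (fun i => K - at1 r (n - i))%N pos vl T)
    \prod_c weight pos vl wt T c); last first.
  transitivity (\det (mxn n (fun i j =>
      EV i (N - at1 mu (n - i)) (K - at1 r (n - i)) j))); last first.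
    (* The row index of [EV] is the column index of [e_entry], and both run backwards. *)
    rewrite -[RHS]det_rev_tr; congr (\det _); apply/matrixP => i j; rewrite !mxE /EV /e_entry.
    have ltin := ltn_ord i; have ltjn := ltn_ord j.
    have -> : (rev_ord i).+1 = (n - i)%N by rewrite /=; lia.
    have -> : (rev_ord j).+1 = (n - j)%N by rewrite /=; lia.
    have ni : (1 <= n - i <= n)%N by lia.
    have muN : (at1 mu (n - i) <= N)%N by apply: leq_trans (subP _) (la_N _); lia.
    by rewrite /idx (subKn muN) (subKn (r_K ni)).
  apply: (@rpp_sum_det R n (fun i => N - at1 mu (n - i))%N (fun i => N - at1 la (n - i))%N
    (fun i => K - at1 s (n - i))%N (fun i => K - at1 r (n - i))%N _ _ pos vl wt EV EW) => //.
  - move=> c; have [cn1 cn2] := in_cell c; have := cell_N c; rewrite pos_n.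
    by rewrite pos1 pos2; split; lia.
  - move=> i j ltin ij; have ijP : (N.+1 - j, n - i)%N \in skew_conj la mu.
      by rewrite in_skew_conj; have := @la_N (n - i); lia.
    exists [` ijP]%fset; rewrite /pos /=; congr (_, _); first by lia.
    by have := @la_N (n - i); lia.
  - move=> i v ltin ne /andP[vr vs].
    have ijP : (at1 la (n - i), n - i)%N \in skew_conj la mu.
      by rewrite in_skew_conj leqnn andbT; have := @la_N (n - i); lia.
    have vM : (K - v < M.+1)%N.
      rewrite ltnS; apply: (@leq_trans (at1 s (n - i))).
        by have := @s_K (n - i); lia.
      exact: (@leq_bigmax _ (fun c : skew_conj la mu => at1 s (val c).2) [` ijP]%fset).
    by exists (Ordinal vM); rewrite /vl /=; have := @r_K (n - i); lia.
  - by move=> i j ij ltjn; apply: leq_sub2l; apply: at1_anti; lia.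
  - by move=> i j ij ltjn; apply: leq_sub2l; apply: at1_anti; lia.
  - by move=> i ltin; apply: leq_sub2l.
  - move=> i ltin ne; have := @flag (n - i.+1)%N.
    have -> : (n - i.+1).+1 = (n - i)%N by lia.
    by case; lia.
  - by move=> i ltin; have := @s_K (n - i); lia.
  - move=> i p S j ltin ltjn ne /andP[rS Ss] /andP[mp lp].
    have pN : (0 < p <= N)%N by lia.
    have S0 : (0 < S <= K)%N by have := @s_K (n - j); lia.
    rewrite EWp // idx_pred // /wt addr0 /EV (_ : (K - S.-1)%N = (K - S).+1); last by lia.
    by rewrite {1}ZX ?e_coefD //; lia.
  - move=> i p S j ltin ltjn ne /andP[rS Ss] /andP[mp lp].
    have pN : (0 < p <= N)%N by lia.
    have S0 : (0 < S <= K)%N by have := @s_K (n - j); lia.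
    rewrite EWp // idx_pred // /wt addr0 /EV (_ : (K - S.-1)%N = (K - S).+1); last by lia.
    by rewrite /EW ZB ?e_coefD //; lia.
  - move=> i p S j ltin ltjn ne /andP[rS Ss] /andP[mp lp].
    have pN : (0 < p <= N)%N by lia.
    have S0 : (0 < S <= K)%N by have := @s_K (n - j); lia.
    rewrite up_entry // EWp // idx_pred // /wt /EV {1}ZX ?e_coefD; [|lia].
    by ring.
  - move=> i p S j ltin ltjn ne /andP[rS Ss] /andP[mp lp].
    have pN : (0 < p <= N)%N by lia.
    have S0 : (0 < S <= K)%N by have := @s_K (n - j); lia.
    rewrite up_entry // EWp // idx_pred // /wt /EW ZB ?e_coefD; [|lia].
    by ring.
  - move=> i t ltin; rewrite /EV; have -> : idx i (N - at1 la (n - i)) i = 0.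
      by rewrite /idx; have := @la_N (n - i); lia.
    by rewrite e_coef0.
  - move=> i t ltin; rewrite /EW; have -> : idx i (N - at1 la (n - i)) i = 0.
      by rewrite /idx; have := @la_N (n - i); lia.
    by rewrite e_coef0.
  - move=> i p t j ltin ltjn lp lt; apply: e_coef_neg; rewrite /idx.
    by have := @la_N (n - j); lia.
  - move=> i p t j ltin ltjn lp lt; apply: e_coef_neg; rewrite /idx.
    by have := @la_N (n - j); lia.
  (* The [x] part is empty, and the remaining sum has one indeterminate fewer than the degree. *)
  - move=> i p t j ij ltjn /andP[mp pl] tr; rewrite /EV /Z X_empty; last by lia.
    have lq : (N - p <= (at1 la (n - j)).-1)%N by have := @la_N (n - j); lia.
    have nij : ((n - j).-1 <= (n - i).-1)%N by lia.
    have [l sz lE] := AB_diff nij lq.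
    have -> : 0 - A_ (n - j).-1 + A_ (n - i).-1 + B_ (at1 la (n - j)).-1 - B_ (N - p) =
        \sum_(v <- l) << v >>.
      by rewrite -lE sub0r addrA (ACl (2*1*3*4)%AC).
    by apply: e_coef_sum; rewrite sz /idx; have := @la_N (n - j); lia.
  - exact: ord0.
(* Rotation reverses the order of cells and complementation that of entries, so together they
   preserve monotonicity. *)
have le_cellE c d : le_cell pos d c =
    ((val c).1 == (val d).1) && ((val c).2 <= (val d).2)%N
    || ((val c).2 == (val d).2) && ((val c).1 <= (val d).1)%N.
  have [c2 _] := in_cell c; have [d2 _] := in_cell d.
  have cN := cell_N c; have dN := cell_N d; rewrite /le_cell !pos1 !pos2.
  move: c2 d2 cN dN; case: (val c) (val d) => [c1 c2] [d1 d2] /= c2n d2n cN dN.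
  have -> : (N.+1 - d1 <= N.+1 - c1)%N = (c1 <= d1)%N by lia.
  have -> : (n - d2 <= n - c2)%N = (c2 <= d2)%N by lia.
  have -> : (n - d2 == n - c2)%N = (c2 == d2)%N by lia.
  have -> : (N.+1 - d1 == N.+1 - c1)%N = (c1 == d1)%N by lia.
  by rewrite orbC; congr (_ || _).
have le_vl (T : {ffun skew_conj la mu -> 'I_M.+1}) c d :
    (vl (T d) <= vl (T c))%N = (T c <= T d)%N.
  by have := ltn_ord (T c); have := ltn_ord (T d); rewrite /vl /K; lia.
have bndE (T : {ffun skew_conj la mu -> 'I_M.+1}) c :
    (K - at1 s (n - (pos c).1) <= vl (T c) <= K - at1 r (n - (pos c).1))%N =
    (at1 r (val c).2 <= T c <= at1 s (val c).2)%N.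
  rewrite pos_n; have [c2 _] := in_cell c; have := s_K c2; have := r_K c2.
  by have := ltn_ord (T c); rewrite /vl /K; lia.
apply: eq_big => [T|T _].
  apply/andP/andP => -[].
    case/andP=> _ /forallP mono /forallP bnd; split.
      apply/forallP => c; apply/forallP => d; have /forallP/(_ c) := mono d.
      by rewrite le_cellE le_vl.
    by apply/forallP => c; rewrite bndE.
  move=> mono /forallP bnd.
  split; last by apply/forallP => c; rewrite -bndE.
  apply/andP; split; apply/forallP => c.
    have [c2 _] := in_cell c; have := bnd c; rewrite bndE => /andP[rT _].
    by apply: leq_trans rT; apply: r_gt0.
  apply/forallP => d; apply/implyP => cd; rewrite -le_vl; apply: (rppP mono).
  by rewrite le_cellE.
rewrite sum_markings; apply: eq_bigr => c _; rewrite /weight /wt vlK pos_n.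
have [c2 _] := in_cell c; have cN := cell_N c.
have -> : eq_right pos T c = up_equal T c.
  apply: eq_existsb => d; rewrite andbA; congr (_ && _).
  have [d2 _] := in_cell d; have := cell_N d.
  by rewrite !pos1 !pos2; case: (val c) (val d) c2 d2 cN => [? ?] [? ?] /=; rewrite xpair_eqE; lia.
have -> : eq_up pos T c = markable T c.
  apply: eq_existsb => d; rewrite andbA; congr (_ && _).
  have [d2 _] := in_cell d; have := cell_N d.
  by rewrite !pos1 !pos2; case: (val c) (val d) c2 d2 cN => [? ?] [? ?] /=; rewrite xpair_eqE; lia.
by rewrite pos_N1.
Qed.
End Col.

Theorem theorem4p5 (n : nat) (la mu : seq nat) (r s : n.-tuple nat)
    (la_part : is_part la) (la_size : (size la <= n)%N)
    (mu_part : is_part mu) (mu_size : (size mu <= n)%N)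
    (rs_gt0 : forall i : nat, (1 <= i <= n)%N ->
       (0 < at1 r i)%N /\ (0 < at1 s i)%N)
    (rs_flag : forall i : nat, (1 <= i < n)%N ->
       (at1 mu i < at1 la i.+1)%N ->
       (at1 r i <= at1 r i.+1)%N /\ (at1 s i <= at1 s i.+1)%N) :
  g_row ivar la mu r s =
    \det (\matrix_(i < n, j < n) h_entry ivar la mu r s i.+1 j.+1)
  /\
  g_col ivar la mu r s =
    \det (\matrix_(i < n, j < n) e_entry ivar la mu r s i.+1 j.+1).
Proof.
have r_gt0 i : (1 <= i <= n)%N -> (0 < at1 r i)%N by move=> /rs_gt0[].
have [sub|nsub] := boolP (subpart mu la); first by split; [apply: row_det|apply: col_det].
have [k lt] : exists k : 'I_n, (at1 la k.+1 < at1 mu k.+1)%N.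
  have /allPn[[|k]] := nsub; first by rewrite mem_iota.
  rewrite mem_iota -ltnNge => km lt.
  have kn : (k < n)%N by lia.
  by exists (Ordinal kn).
(* Where [mu] exceeds [la] in row [k], the entries in rows from [k] on and columns up to [k] have
   negative degree; this zero block makes the determinant vanish. *)
have neg (a b : 'I_n) : (b <= k <= a)%N ->
    (at1 la a.+1)%:Z - (at1 mu b.+1)%:Z - a.+1%:Z + b.+1%:Z < 0 :> int.
  move=> /andP[bk ka].
  have := @at1_anti la k.+1 a.+1 la_part; have := @at1_anti mu b.+1 k.+1 mu_part; lia.
rewrite /g_row /g_col (negPf nsub); split.
  by rewrite (@det_zero_corner_ll _ _ _ k) // => a b ab; rewrite mxE /h_entry h_coef_neg ?neg.
by rewrite (@det_zero_corner_ll _ _ _ k) // => a b ab; rewrite mxE /e_entry e_coef_neg ?neg.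
Qed.
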